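(* The set $\Sigma_{kn} \cap \{z \in \mathbb{C} : |z| \geq 1\}$ is connected, and the set $\Sigma_{kn} \cap \{z \in \mathbb{C} : |z| > 1\}$ is locally connected.
   Context: For $c \in [-2,1/4]$ let $f_c(z) := z^2+c$; $f_c$ is superattracting if the critical point $0$ is periodic. For real $x \neq 0$ let $\epsilon(x) = -1$ if $x<0$ and $\epsilon(x)=+1$ if $x>0$, and for $k \ge 1$ let $\eta_k(x) := \epsilon(x)\epsilon(f_c(x))\cdots\epsilon(f_c^{k-1}(x))$. If the forward orbit of $x$ does not contain $0$, the kneading series of $x$ is $K(x,t) := 1 + \sum_{k=1}^\infty \eta_k(x) t^k$. The kneading determinant of $f_c$ is $K_c(t) := K(c,t)$ if $0$ is not periodic, and otherwise $K_c(t) := \lim_{x \to c^+} K(x,t)$ (coefficientwise limit, over $x$ whose forward orbit avoids $0$). If $0$ is periodic of period $p$, then $K_c(t) = P(t)/(1-t^p)$ with $P$ a polynomial of degree $p-1$ with coefficients in $\{\pm 1\}$, and $K_c$ is regarded as this rational function. The kneading spectrum is $$\Sigma_{kn} := \overline{\{ s \in \mathbb{C}^* : K_c(1/s) = 0 \text{ for some superattracting } f_c,\ c \text{ real}\}}.$$ *)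

(* Defs.v *)
From HB Require Import structures.
From mathcomp Require Import all_boot all_order all_algebra.
From mathcomp Require Import fraction complex.
From mathcomp Require Import all_classical all_reals all_analysis.

Set Implicit Arguments.
Unset Strict Implicit.
Unset Printing Implicit Defensive.

Import Order.TTheory GRing.Theory Num.Theory.
Import numFieldNormedType.Exports.

Local Open Scope classical_set_scope.
Local Open Scope ring_scope.
Local Open Scope complex_scope.

Local Notation "x %:F" := (tofrac x).

(* The usual topology of the complex numbers, given by the modulus. *)
HB.instance Definition _ (R : realType) := NormedModule.copy R[i] R[i]^o.


Definition quad (R : realType) (c x : R) : R := x ^+ 2 + c.

Definition zero_periodic (R : realType) (c : R) : Prop :=
  exists2 p, (0 < p)%N & iter p (quad c) 0 = 0.

Definition zero_period (R : realType) (c : R) (p : nat) : Prop :=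
  [/\ (0 < p)%N, iter p (quad c) 0 = 0
    & forall q, (0 < q < p)%N -> iter q (quad c) 0 <> 0].

Definition superattracting (R : realType) (c : R) : Prop :=
  c \in `[-2, 1 / 4] /\ zero_periodic c.

Definition orbit_avoids0 (R : realType) (c : R) : set R :=
  [set x | forall n, iter n (quad c) x != 0].

(* The sign epsilon is [Num.sg]; the value [Num.sg 0 = 0] is never relevant,
   as [eta] is only used at points of [orbit_avoids0 c].  Since the empty
   product is 1, [eta c 0 x] is the constant coefficient of K(x,t). *)
Definition eta (R : realType) (c : R) (k : nat) (x : R) : R :=
  \prod_(j < k) Num.sg (iter j (quad c) x).

(* The coefficient of t^k in the formal power series K_c(t). *)
Definition kneading_coef (R : realType) (c : R) (k : nat) : R :=
  if `[< zero_periodic c >]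
  then lim (eta c k x @[x --> within (orbit_avoids0 c) c^'+])
  else eta c k c.

(* K_c as a rational function, for 0 periodic of period p: the sum below is
   the coefficient of t^n in (1 - t^p) K_c(t), so the second condition is the
   identity P(t) = (1 - t^p) K_c(t) of formal power series. *)
Definition is_kneading_ratfun (R : realType) (c : R)
    (F : {fraction {poly R[i]}}) : Prop :=
  exists (p : nat) (P : {poly R[i]}),
    [/\ zero_period c p,
        forall n, P`_n = \sum_(j < n.+1)
          (1 - 'X^p : {poly R[i]})`_j * (kneading_coef c (n - j))%:C
      & F = P%:F / (1 - 'X^p)%:F].

(* Vanishing at t after cancellation of common factors: F may have a
   representation whose numerator and denominator both vanish at t. *)
Definition ratfun_root (K : fieldType) (F : {fraction {poly K}}) (t : K) :
    Prop :=
  exists A B : {poly K}, [/\ F = A%:F / B%:F, B.[t] != 0 & A.[t] = 0].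

Definition kneading_spectrum (R : realType) : set R[i] :=
  closure [set s : R[i] | s != 0 /\
    exists c : R, superattracting c /\
      exists F, is_kneading_ratfun c F /\ ratfun_root F s^-1].

(* Local connectedness of A for the subspace topology: the connected
   relatively open subsets of A form a basis. *)
Definition locally_connected (T : topologicalType) (A : set T) : Prop :=
  forall (x : T) (U : set T), A x -> open U -> U x ->
    exists V : set T, [/\ open V, V x, A `&` V `<=` U & connected (A `&` V)].

(* Main.v *)
Require Import Defs.
From mathcomp Require Import all_boot all_order all_algebra.
From mathcomp Require Import complex fraction.
From mathcomp Require Import all_classical all_reals all_analysis.
From mathcomp Require Import ring lra zify.
Import Order.TTheory GRing.Theory Num.Theory.
Import numFieldNormedType.Exports.
Local Open Scope classical_set_scope.
Local Open Scope ring_scope.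
Local Open Scope complex_scope.
Set Implicit Arguments.
Unset Strict Implicit.
Unset Printing Implicit Defensive.

(** Write t = 1/s, and for real c let g_c(t) be the sum of the eta_k(c) t^k with
the convention that 0 has sign 0.  If 0 is not periodic, g_c is K_c.  If 0 has
period p, the coefficients vanish from t^p on, and g_c is the polynomial P with
K_c = P / (1 - t^p).  In both cases g_c and K_c have the same zeros in the open
unit disc.

The zeros of g_c in the open unit disc vary continuously with c
([nonvanish_near], [vanish_persists]).  Where 0 is not periodic every coefficient
is locally constant in c, and this is Hurwitz' theorem ([hurwitz]).  Near a
superattracting parameter the critical orbit stays close to the cycle
([superattracting_near]), so that the nearby g are P multiplied by 1 or by
1 / (1 +- t^p): the series jumps, its zeros in the disc do not move
([vanish_near_period]).

It follows that, outside the unit circle, the spectrum is the set of all s with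
g_c(1/s) = 0 for some c in [-2, 1/4], superattracting or not
([spectrum_outside]): a parameter that superattracting ones do not approach lies
in an interval on which g_c is constant, so its zeros are also zeros of a g_b
where b is a limit of superattracting parameters.

Zeros can then be followed along parameters: a compact set of zeros that is open
among all zeros over a connected set of parameters has a point over each of these
parameters ([continuation]).  Two consequences give the theorem.

Connectedness.  As g_0 = 1 has no zeros, a nonempty clopen part of the spectrum
in |s| >= 1 cannot avoid the unit circle ([clopen_meets_circle]).  The circle is
connected, and it lies in the spectrum: near c = -2 there are superattracting
parameters with (1 - t) P(t) = 1 - 2t + t^n ([tip_polynomial]), and the roots of
these polynomials accumulate at every point of the circle ([root_near_circle]).

Local connectedness.  Let s0 be a zero for the parameter c, and take a disc
around s0 with no other zero for c.  Over a short interval around c no zero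
crosses the boundary of the disc, so every clopen set of zeros in the disc can be
followed back to c, where it must contain s0; hence these zeros form a connected
set.  Compactness of [-2, 1/4] makes finitely many such intervals sufficient
([outer_zeros_cik]).

The complex analysis behind this is elementary, and done on partial sums.  The
minimum principle comes from Graeffe's root squaring ([min_modulus_center]), the
maximum principle from splitting off even parts ([max_modulus_center]), and the
isolation of zeros from Jensen's bound on their number ([zeros_bound]). *)

Local Notation orb c k := (iter k (quad c) c).

(** * Real-valued modulus *)
Section Modulus.
Variable R : realType.
Implicit Types z w : R[i].

(** The norm of R[i] takes its values in R[i], where the order is partial;
    estimates are made on this real number instead. *)
Definition cmod z : R := ComplexField.Normc.normc z.

Lemma cmodE z : `|z| = (cmod z)%:C. Proof. by []. Qed.

Lemma cmod0 : cmod 0 = 0. Proof. exact: ComplexField.Normc.normc0. Qed.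
Lemma cmod1 : cmod 1 = 1. Proof. exact: ComplexField.Normc.normc1. Qed.
Lemma cmodM z w : cmod (z * w) = cmod z * cmod w.
Proof. exact: ComplexField.Normc.normcM. Qed.
Lemma cmodV z : cmod z^-1 = (cmod z)^-1.
Proof. exact: ComplexField.Normc.normcV. Qed.
Lemma cmodD z w : cmod (z + w) <= cmod z + cmod w.
Proof. by rewrite -lecR rmorphD -!cmodE ler_normD. Qed.
Lemma cmodN z : cmod (- z) = cmod z.
Proof. by apply: complexI; rewrite -!cmodE normrN. Qed.
Lemma cmod_ge0 z : 0 <= cmod z.
Proof. by rewrite -lecR -cmodE normr_ge0. Qed.
Lemma cmod_eq0 z : (cmod z == 0) = (z == 0).
Proof.
by apply/eqP/eqP => [/ComplexField.Normc.eq0_normc //|->]; exact: cmod0.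
Qed.
Lemma cmod_gt0 z : (0 < cmod z) = (z != 0).
Proof. by rewrite lt0r cmod_eq0 cmod_ge0 andbT. Qed.
Lemma cmodX z n : cmod (z ^+ n) = cmod z ^+ n.
Proof. by elim: n => [|n IH]; rewrite ?expr0 ?cmod1 // !exprS cmodM IH. Qed.
Lemma cmodR (x : R) : cmod x%:C = `|x|.
Proof. by rewrite /cmod /= expr0n /= addr0 sqrtr_sqr. Qed.
Lemma cmodBC z w : cmod (z - w) = cmod (w - z).
Proof. by rewrite -cmodN opprB. Qed.
Lemma cmodB_le z w : cmod (z - w) <= cmod z + cmod w.
Proof. by rewrite -(cmodN w) cmodD. Qed.
Lemma cmodB_ge z w : cmod z - cmod w <= cmod (z - w).
Proof. by rewrite lerBlDr -{1}(subrK w z) cmodD. Qed.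
Lemma cmod_tri z w u : cmod (z - u) <= cmod (z - w) + cmod (w - u).
Proof. by have := cmodD (z - w) (w - u); rewrite addrA subrK. Qed.
Lemma cmod_prod (I : Type) (r : seq I) (P : pred I) (F : I -> R[i]) :
  cmod (\prod_(i <- r | P i) F i) = \prod_(i <- r | P i) cmod (F i).
Proof. exact: (big_morph _ cmodM cmod1). Qed.
Lemma cmod_conj z : cmod z^* = cmod z.
Proof. by apply: complexI; rewrite -!cmodE normcJ. Qed.
Lemma cmod_nat n : cmod n%:R = n%:R.
Proof. by rewrite -(rmorph_nat (real_complex R)) cmodR ger0_norm. Qed.

End Modulus.

(** * Minimum and maximum principles for polynomials *)
Section PolynomialModulus.
Variable R : realType.
Implicit Types p : {poly R[i]}.

Lemma expr_small (q e : R) : 0 <= q < 1 -> 0 < e ->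
  exists n, forall m, (n <= m)%N -> q ^+ m < e.
Proof.
case/andP=> q0 q1 e0.
have : (q ^+ n @[n --> \oo] --> (0 : R))%classic by apply: cvg_expr; rewrite ger0_norm.
move/cvgrPdist_lt => /(_ _ e0) [n _ Hn]; exists n => m /Hn.
by rewrite sub0r normrN ger0_norm ?exprn_ge0.
Qed.

(** Taking 2^k-th roots removes the constant B in the limit. *)
Lemma le_of_exp2n (x y B : R) : 0 <= x -> 0 <= y ->
  (forall k, x ^+ (2 ^ k) <= B * y ^+ (2 ^ k)) -> x <= y.
Proof.
move=> x0 y0 H; rewrite leNgt; apply/negP => yx.
have xp : 0 < x by exact: le_lt_trans yx.
have B1 : forall k, 1 <= B * (y / x) ^+ (2 ^ k).
  by move=> k; rewrite expr_div_n mulrA ler_pdivlMr ?exprn_gt0 // mul1r.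
have q1 : y / x < 1 by rewrite ltr_pdivrMr ?mul1r.
have q0 : 0 <= y / x by rewrite divr_ge0 // ltW.
have Bp : 0 < B.
  have := B1 0%N; rewrite expr1; case: (ltP 0 B) => // B0.
  have := mulr_le0_ge0 B0 q0; lra.
have q01 : 0 <= y / x < 1 by rewrite q0.
have BVp : 0 < B^-1 by rewrite invr_gt0.
have [n Hn] := expr_small q01 BVp.
have := Hn (2 ^ n)%N (ltnW (ltn_expl n (ltnSn 1))).
rewrite -(ltr_pM2l Bp) mulfV ?gt_eqF //.
by move/lt_le_trans => /(_ _ (B1 n)); rewrite ltxx.
Qed.

(** For z = y^2 the factor z - r^2 is -(y - r)(-y - r), and both y and -y lie on
    the circle of radius the square root; so squaring all roots and the radius
    squares the lower bound. *)
Lemma graeffe (rs : seq R[i]) (rho mu : R) : 0 <= mu -> 0 <= rho ->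
  (forall z, cmod z = rho -> mu <= cmod (\prod_(r <- rs) (z - r))) ->
  forall k z, cmod z = rho ^+ (2 ^ k) ->
    mu ^+ (2 ^ k) <= cmod (\prod_(r <- rs) (z - r ^+ (2 ^ k))).
Proof.
move=> mu0 rho0 H; elim=> [|k IH] z hz.
  by rewrite expr1 (eq_bigr (fun r => z - r)) ?H // => i _; rewrite expr1.
set y := sqrtc z.
have yz : y ^+ 2 = z by exact: sqr_sqrtc.
have hy : cmod y = rho ^+ (2 ^ k).
  apply/eqP; rewrite -(@eqrXn2 _ 2) ?cmod_ge0 ?exprn_ge0 //.
  by rewrite -cmodX yz hz -exprM -expnSr.
rewrite (eq_bigr (fun r => (y - r ^+ (2 ^ k)) * - (- y - r ^+ (2 ^ k)))); last first.
  by move=> r _; rewrite -yz expnSr exprM; ring.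
rewrite big_split /= cmodM expnSr exprM expr2 ler_pM ?exprn_ge0 //; first exact: IH.
rewrite cmod_prod (eq_bigr (fun r => cmod (- y - r ^+ (2 ^ k)))) -?cmod_prod.
  by apply: IH; rewrite cmodN.
by move=> r _; rewrite cmodN.
Qed.

(** With K = 2^k and roots r counted from t0, root squaring gives
    mu^K <= prod |z - r^K| for |z| = rho^K when p is monic.  As rho <= |r|, the
    right-hand side is at most 2^n prod |r|^K = 2^n |p(t0)|^K, and the factor 2^n
    disappears on taking K-th roots. *)
Lemma min_modulus_center p (t0 : R[i]) (rho mu : R) : 0 <= rho -> 0 <= mu ->
  (forall z, cmod (z - t0) = rho -> mu <= cmod p.[z]) ->
  (forall z, cmod (z - t0) < rho -> ~~ root p z) ->
  mu <= cmod p.[t0].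
Proof.
move=> rho0 mu0 Hc Hr.
have [p0|p0] := eqVneq p 0.
  have hz : cmod (t0 + rho%:C - t0) = rho.
    by rewrite addrAC subrr add0r cmodR ger0_norm.
  by have := Hc _ hz; rewrite p0 !horner0.
have [rs prs] := closed_field_poly_normal p.
have l0 : lead_coef p != 0 by rewrite lead_coef_eq0.
have lp : 0 < cmod (lead_coef p) by rewrite cmod_gt0.
have pE z : p.[z] = lead_coef p * \prod_(r <- rs) (z - r).
  rewrite {1}prs hornerZ horner_prod; congr (_ * _).
  by apply: eq_bigr => r _; rewrite hornerXsubC.
pose ss := [seq r - t0 | r <- rs].
have G : forall k z, cmod z = rho ^+ (2 ^ k) ->
    (mu / cmod (lead_coef p)) ^+ (2 ^ k) <= cmod (\prod_(r <- ss) (z - r ^+ (2 ^ k))).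
  apply: graeffe => //; first by rewrite divr_ge0 // ltW.
  move=> z hz; rewrite big_map ler_pdivrMr // mulrC -cmodM.
  rewrite (eq_bigr (fun r => (z + t0) - r)); last by move=> r _; rewrite opprB addrA addrAC.
  by rewrite -pE Hc // addrK.
have rge r : r \in ss -> rho <= cmod r.
  case/mapP => x xrs ->; rewrite leNgt; apply/negP => /Hr.
  rewrite prs rootZ // root_prod_XsubC => /negP; exact.
rewrite pE cmodM mulrC -ler_pdivrMr //.
apply: (@le_of_exp2n _ _ (2 ^+ size ss)); [by rewrite divr_ge0 // ltW|exact: cmod_ge0|].
move=> k; have hz : cmod (rho ^+ (2 ^ k))%:C = rho ^+ (2 ^ k).
  by rewrite cmodR ger0_norm // exprn_ge0.
apply: (le_trans (G k _ hz)).
rewrite !cmod_prod -prodrXl.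
have -> : \prod_(r <- rs) cmod (t0 - r) ^+ (2 ^ k) = \prod_(r <- ss) cmod r ^+ (2 ^ k).
  by rewrite big_map; apply: eq_bigr => r _; rewrite cmodBC.
have -> : 2 ^+ size ss = \prod_(r <- ss) (2 : R).
  by rewrite big_const_seq count_predT -Monoid.iteropE.
rewrite -big_split /= big_seq [leRHS]big_seq; apply: ler_prod => r rss.
rewrite cmod_ge0 /= (le_trans (cmodB_le _ _)) // hz cmodX mulr_natl mulr2n lerD2r.
by rewrite lerXn2r ?nnegrE ?cmod_ge0 // rge.
Qed.

(** Write p(z) = e(z^2) + z o(z^2).  The value e(z^2) is the mean of p(z) and
    p(-z), so e inherits the bound on the circle of radius rho^2; it has the same
    value at 0 as p and about half its size. *)
Lemma max_modulus_center p (rho M : R) : 0 <= rho ->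
  (forall z, cmod z = rho -> cmod p.[z] <= M) -> cmod p.[0] <= M.
Proof.
elim: {p}(size p).+1 {-2}p (ltnSn (size p)) rho => // n IH p; rewrite ltnS => hp rho rho0 H.
have [s1|s1] := leqP (size p) 1.
  have := H rho%:C; rewrite cmodR ger0_norm // => /(_ erefl).
  by rewrite (size1_polyC s1) !hornerC.
have pe x : p.[x] = (even_poly p).[x ^+ 2] + (odd_poly p).[x ^+ 2] * x.
  by rewrite -{1}(poly_even_odd p) !hornerE !horner_comp !hornerE.
have -> : p.[0] = (even_poly p).[0] by rewrite pe expr0n /= mulr0 addr0.
apply: (IH _ _ (rho ^+ 2)) => [||z hz]; last 2 first.
- by rewrite exprn_ge0.
- set y := sqrtc z; have yz : y ^+ 2 = z by exact: sqr_sqrtc.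
  have hy : cmod y = rho.
    by apply/eqP; rewrite -(@eqrXn2 _ 2) ?cmod_ge0 // -cmodX yz hz.
  have := lerD (H y hy) (H (- y) _); rewrite cmodN => /(_ hy).
  move/(le_trans (cmodD _ _)); rewrite !pe sqrrN yz mulrN addrACA subrr addr0.
  by rewrite -mulr2n -mulr_natl cmodM cmod_nat; lra.
rewrite (leq_ltn_trans (size_even_poly _)) //.
by move: s1 hp; clear; lia.
Qed.

End PolynomialModulus.

(** * Zeros of power series with coefficients bounded by one *)
Section PowerSeries.
Variable R : realType.
Implicit Types (a b : nat -> R[i]) (t z : R[i]).

Definition psum a N : {poly R[i]} := \poly_(k < N) a k.

Lemma psum0 a t : (psum a 0).[t] = 0.
Proof. by rewrite horner_poly big_ord0. Qed.

Lemma psumS a N t : (psum a N.+1).[t] = (psum a N).[t] + a N * t ^+ N.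
Proof. by rewrite !horner_poly big_ord_recr. Qed.

Lemma eq_psum a b N : (forall k, (k < N)%N -> a k = b k) -> psum a N = psum b N.
Proof. by move=> ab; apply/polyP => k; rewrite !coef_poly; case: ifP => // /ab. Qed.

(** A power series with coefficients of modulus at most 1 vanishes at t, where
    |t| < 1, exactly when each partial sum S_N(t) is at most the bound
    |t|^N / (1 - |t|) of the remaining tail.  The gap compares the two sides.  It is
    nondecreasing in N and involves N coefficients only, so that vanishing is the
    intersection of a decreasing sequence of closed conditions. *)
Definition gap a N t : R := cmod (psum a N).[t] * (1 - cmod t) - cmod t ^+ N.

Definition vanish a t := forall N, gap a N t <= 0.

Definition sub_unit a := forall k, cmod (a k) <= 1.

(** By the triangle inequality one more term lowers |S_N| by at most |t|^N, and
    (1 - |t|) |t|^N is what the second term of the gap gains. *)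
Lemma gap_homo a t N M : sub_unit a -> cmod t <= 1 -> (N <= M)%N ->
  gap a N t <= gap a M t.
Proof.
move=> a1 t1 /subnK <-; elim: (M - N)%N => // k; move/le_trans; apply.
rewrite /gap addSn psumS exprS.
set S := (psum a _).[t]; set y := a _ * _.
have h : cmod S <= cmod (S + y) + cmod t ^+ (k + N).
  have := cmodB_le (S + y) y; rewrite addrK => /le_trans; apply.
  by rewrite lerD2l cmodM cmodX ler_piMl // exprn_ge0 // cmod_ge0.
have t1' : 0 <= 1 - cmod t by rewrite subr_ge0.
by have := ler_wpM2r t1' h; nra.
Qed.

Lemma psum_tail a t N M : sub_unit a -> (N <= M)%N ->
  cmod t <= 1 ->
  cmod ((psum a M).[t] - (psum a N).[t]) * (1 - cmod t) <= cmod t ^+ N - cmod t ^+ M.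
Proof.
move=> a1 NM t1; elim: M NM => [|M IH].
  by rewrite leqn0 => /eqP ->; rewrite !subrr cmod0 mul0r.
rewrite leq_eqVlt => /predU1P[->|]; first by rewrite !subrr cmod0 mul0r.
rewrite ltnS => /IH {}IH; rewrite psumS addrAC.
have t1' : 0 <= 1 - cmod t by rewrite subr_ge0.
apply: (le_trans (ler_wpM2r t1' (cmodD _ _))); rewrite mulrDl exprS.
have : cmod (a M * t ^+ M) <= cmod t ^+ M.
  by rewrite cmodM cmodX ler_piMl // exprn_ge0 // cmod_ge0.
by move/(ler_wpM2r t1'); lra.
Qed.

(** The form of vanishing that division by X - t0 preserves: the quotient series
    need not have coefficients bounded by 1. *)
Definition geom_small a t := exists C : R, forall N, cmod (psum a N).[t] <= C * cmod t ^+ N.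

Lemma vanish_geom a t : cmod t < 1 -> vanish a t -> geom_small a t.
Proof.
move=> t1 v; exists (1 - cmod t)^-1 => N; rewrite mulrC ler_pdivlMr ?subr_gt0 //.
by have := v N; rewrite subr_le0.
Qed.

(** The coefficients of the quotient of the power series a by X - t0.  They are
    bounded because the partial sums of a at t0 are O(|t0|^N). *)
Definition quotient_coef a t0 k := - (psum a k.+1).[t0] / t0 ^+ k.+1.

Lemma psum_quot a t0 t N : t0 != 0 ->
  (psum a N).[t] =
    (t - t0) * (psum (quotient_coef a t0) N).[t] + (psum a N).[t0] / t0 ^+ N * t ^+ N.
Proof.
move=> t00; elim: N => [|N IH]; first by rewrite !psum0; ring.
rewrite !psumS IH /quotient_coef !psumS !exprS; field.
by rewrite t00 expf_neq0.
Qed.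

(** Repeated division by X - t: the other zeros remain zeros of the quotient
    since they differ from t, and each division perturbs partial sums by O(|z|^N). *)
Lemma divide_zeros a (ts : seq R[i]) : uniq ts ->
  (forall t, t \in ts -> t != 0 /\ geom_small a t) ->
  exists h C, [/\ 0 <= C, a 0%N = \prod_(t <- ts) (- t) * h 0%N
    & forall N z, cmod z <= 1 ->
      cmod (\prod_(t <- ts) (z - t) * (psum h N).[z])
        <= cmod (psum a N).[z] + C * cmod z ^+ N].
Proof.
elim: ts a => [a _ _|t0 ts IH a /= /andP[t0ts uts] Hts].
  exists a, 0; split=> [//||N z _]; first by rewrite big_nil mul1r.
  by rewrite big_nil mul1r mul0r addr0.
have [t00 [C0 HC0]] := Hts t0 (mem_head _ _).
have [|h [C [C_ge0 h0 Hh]]] := IH (quotient_coef a t0) uts.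
  move=> t tts; have [|t_n0 [C1 HC1]] := Hts t; first by rewrite inE tts orbT.
  have tt0 : t - t0 != 0 by rewrite subr_eq0; apply: contraNneq t0ts => <-.
  have tt0p : 0 < cmod (t - t0) by rewrite cmod_gt0.
  split=> //; exists ((C1 + C0) / cmod (t - t0)) => N.
  rewrite mulrAC ler_pdivlMr // -cmodM mulrC.
  have -> : (t - t0) * (psum (quotient_coef a t0) N).[t] =
     (psum a N).[t] - (psum a N).[t0] / t0 ^+ N * t ^+ N.
    by rewrite (psum_quot a t N t00) addrK.
  rewrite (le_trans (cmodB_le _ _)) // mulrDl lerD // cmodM cmodX ler_wpM2r ?exprn_ge0 ?cmod_ge0 //.
  by rewrite cmodM cmodV cmodX ler_pdivrMr // exprn_gt0 // cmod_gt0.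
exists h, (C0 + (1 + cmod t0) * C); split.
- rewrite addr_ge0 ?mulr_ge0 ?addr_ge0 ?cmod_ge0 //.
  by have := HC0 0%N; rewrite psum0 cmod0 mulr1.
- rewrite big_cons -mulrA -h0 /quotient_coef psumS psum0 add0r expr0 mulr1 expr1.
  by field.
- move=> N z z1; rewrite big_cons -mulrA cmodM.
  apply: (le_trans (ler_wpM2l (cmod_ge0 _) (Hh N z z1))).
  rewrite mulrDr -cmodM.
  have -> : (z - t0) * (psum (quotient_coef a t0) N).[z] =
     (psum a N).[z] - (psum a N).[t0] / t0 ^+ N * z ^+ N.
    by rewrite (psum_quot a z N t00) addrK.
  have zN : 0 <= cmod z ^+ N by rewrite exprn_ge0 ?cmod_ge0.
  have h1 : cmod ((psum a N).[t0] / t0 ^+ N * z ^+ N) <= C0 * cmod z ^+ N.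
    rewrite cmodM cmodX ler_wpM2r // cmodM cmodV cmodX ler_pdivrMr //.
    by rewrite exprn_gt0 // cmod_gt0.
  have h2 : cmod (z - t0) * (C * cmod z ^+ N) <= (1 + cmod t0) * (C * cmod z ^+ N).
    rewrite ler_wpM2r ?mulr_ge0 // (le_trans (cmodB_le _ _)) // lerD2r //.
  have := cmodB_le (psum a N).[z] ((psum a N).[t0] / t0 ^+ N * z ^+ N).
  lra.
Qed.

(** Jensen's inequality.  Let h be the quotient of a by its k zeros ts.  On |z| = s
    the product of the s^2 - t^* z has modulus s^k prod |z - t|, so its product with
    a partial sum of h is bounded there as that of a is.  The maximum principle at 0
    gives s^k |h_0| <= B, whereas |h_0| = 1 / prod |t| >= rho^-k. *)
Lemma zeros_bound a (rho : R) : sub_unit a -> a 0%N = 1 -> 0 < rho < 1 ->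
  exists K, forall ts : seq R[i], uniq ts ->
    (forall t, t \in ts -> cmod t <= rho /\ vanish a t) -> (size ts <= K)%N.
Proof.
move=> a1 a01 /andP[rho0 rho1].
(* any radius strictly between rho and 1 *)
pose s := (1 + rho) / 2.
have s1 : s < 1 by rewrite /s; lra.
have rs : rho < s by rewrite /s; lra.
have s0 : 0 < s by rewrite /s; lra.
have q01 : 0 <= rho / s < 1 by rewrite divr_ge0 ?ltW //= ltr_pdivrMr // mul1r.
pose B := (1 - s)^-1 + 1.
have B0 : 0 < B by rewrite addr_gt0 // invr_gt0 subr_gt0.
have B0V : 0 < B^-1 by rewrite invr_gt0.
have [K HK] := expr_small q01 B0V.
exists K => ts uts Hts; rewrite leqNgt; apply/negP => /ltnW Kts.
have tn0 t : t \in ts -> t != 0.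
  move=> /Hts[_ v]; apply/eqP => t0; have := v 1%N.
  by rewrite /gap psumS psum0 t0 cmod0 expr0 expr1 a01 add0r mulr1 cmod1; lra.
have [|h [C [C0 h0 Hh]]] := @divide_zeros a ts uts.
  move=> t tts; split; first exact: tn0.
  by have [tr v] := Hts t tts; apply: vanish_geom => //; exact: le_lt_trans rho1.
have s01 : 0 <= s < 1 by rewrite s1 ltW.
have CV : 0 < (C + 1)^-1 by rewrite invr_gt0 ltr_wpDl.
have [N HN] := expr_small s01 CV.
pose q := \prod_(t <- ts) ((s ^+ 2)%:C%:P - (t^*)%:P * 'X) * psum h N.+1.
have qE z : q.[z] = \prod_(t <- ts) ((s ^+ 2)%:C - t^* * z) * (psum h N.+1).[z].
  rewrite hornerM horner_prod; congr (_ * _).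
  by apply: eq_bigr => t _; rewrite !hornerE.
have Hq z : cmod z = s -> cmod q.[z] <= s ^+ size ts * B.
  move=> zs; rewrite qE cmodM.
  have -> : cmod (\prod_(t <- ts) ((s ^+ 2)%:C - t^* * z)) =
      s ^+ size ts * cmod (\prod_(t <- ts) (z - t)).
    rewrite !cmod_prod; have -> : s ^+ size ts = \prod_(t <- ts) s.
      by rewrite big_const_seq count_predT -Monoid.iteropE.
    rewrite -big_split /=; apply: eq_bigr => t _.
    have -> : (s ^+ 2)%:C = z^* * z.
      by rewrite mulrC -sqr_normc cmodE zs rmorphXn.
    by rewrite -mulrBl -rmorphB cmodM cmod_conj zs mulrC.
  rewrite -mulrA -cmodM ler_wpM2l ?exprn_ge0 ?(ltW s0) //.
  apply: (le_trans (Hh _ _ _)); first by rewrite zs ltW.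
  rewrite /B zs lerD //.
    have := @psum_tail a z 0 N.+1 a1 (leq0n _); rewrite zs => /(_ (ltW s1)).
    rewrite psum0 subr0 expr0 -ler_pdivlMr ?subr_gt0 // => /le_trans; apply.
    by rewrite ler_piMl ?invr_ge0 ?subr_ge0 ?(ltW s1) // gerBl exprn_ge0 // ltW.
  have := HN _ (leqnSn N); rewrite -(ltr_pM2l (_ : 0 < C + 1)) ?ltr_wpDl //.
  rewrite mulfV ?gt_eqF ?ltr_wpDl //.
  have p0 : 0 <= s ^+ N.+1 by rewrite exprn_ge0 // ltW.
  by move=> h1; have := ltW h1; rewrite -/(s ^+ N.+1); lra.
have := max_modulus_center (ltW s0) Hq.
rewrite qE (eq_bigr (fun=> (s ^+ 2)%:C)); last by move=> t _; rewrite mulr0 subr0.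
have -> : \prod_(t <- ts) (s ^+ 2)%:C = (s ^+ 2)%:C ^+ size ts.
  by rewrite big_const_seq count_predT -Monoid.iteropE.
rewrite horner_coef0 coef_poly /= cmodM cmodX cmodR ger0_norm ?exprn_ge0 ?(ltW s0) //.
rewrite -exprM mulnC mulnC mul2n -addnn exprD -mulrA ler_pM2l ?exprn_gt0 // => hB.
have prod1 : 1 <= rho ^+ size ts * cmod (h 0%N).
  rewrite -cmod1 -a01 h0 cmodM ler_wpM2r ?cmod_ge0 // cmod_prod.
  have -> : rho ^+ size ts = \prod_(t <- ts) rho.
    by rewrite big_const_seq count_predT -Monoid.iteropE.
  rewrite big_seq [leRHS]big_seq; apply: ler_prod => t tts.
  by rewrite cmodN cmod_ge0; case: (Hts t tts).
have := HK _ Kts; apply/negP; rewrite -leNgt.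
rewrite expr_div_n ler_pdivlMr ?exprn_gt0 // mulrC ler_pdivrMr //.
have p0 : 0 <= rho ^+ size ts by rewrite exprn_ge0 // ltW.
have := ler_wpM2l p0 hB; apply: le_trans.
by rewrite mulrCA ler_peMr // exprn_ge0 // ltW.
Qed.

Lemma zeros_finite a (rho : R) : sub_unit a -> a 0%N = 1 -> 0 < rho < 1 ->
  exists L : seq R[i], forall t, cmod t <= rho -> vanish a t -> t \in L.
Proof.
move=> a1 a01 rho01; have [K HK] := zeros_bound a1 a01 rho01.
(* a longest list of distinct zeros contains all zeros *)
pose P n := `[< exists ts : seq R[i], [/\ uniq ts, size ts = n &
  forall t, t \in ts -> cmod t <= rho /\ vanish a t] >].
have P0 : exists n, P n by exists 0%N; apply/asboolP; exists [::].
have Pb n : P n -> (n <= K)%N by move=> /asboolP[ts [uts <- /HK]]; apply.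
have [n /asboolP[L [uL sL HL]] Hmax] := ex_maxnP P0 Pb.
exists L => t tr vt; apply/negPn/negP => tL.
have /Hmax : P n.+1; last by rewrite ltnn.
apply/asboolP; exists (t :: L); split => /=; [by rewrite tL|by rewrite sL|].
by move=> u; rewrite inE => /predU1P[->//|/HL].
Qed.

Lemma isolated_zero a t0 : sub_unit a -> a 0%N = 1 -> cmod t0 < 1 ->
  exists2 r, 0 < r & forall t, cmod (t - t0) <= r ->
    cmod t < 1 /\ (vanish a t -> t = t0).
Proof.
move=> a1 a01 t01.
have t0p := cmod_ge0 t0.
have rho01 : 0 < (1 + cmod t0) / 2 < 1 by apply/andP; split; lra.
have [L HL] := zeros_finite a1 a01 rho01.
have [r1 r10 Hr1] : exists2 r, 0 < r & forall t, t \in L -> t != t0 -> r < cmod (t - t0).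
  elim: L {HL} => [|u L [r r0 Hr]]; first by exists 1.
  have [->|ut0] := eqVneq u t0.
    by exists r => // t; rewrite inE => /predU1P[->|/Hr //]; rewrite eqxx.
  have u0 : 0 < cmod (u - t0) by rewrite cmod_gt0 subr_eq0.
  exists (Num.min r (cmod (u - t0) / 2)); first by rewrite lt_min r0 divr_gt0.
  move=> t; rewrite inE => /predU1P[-> _|tL tt0]; rewrite gt_min.
    by apply/orP; right; lra.
  by rewrite Hr.
exists (Num.min r1 ((1 - cmod t0) / 2)); first by rewrite lt_min r10 divr_gt0 ?subr_gt0.
move=> t; rewrite le_min => /andP[tr tt].
have : cmod t <= (1 + cmod t0) / 2.
  by have := cmodB_ge t t0; lra.
move=> trho; split; first lra.
move=> vt; apply/eqP/negPn/negP => tt0.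
by have := Hr1 t (HL t trho vt) tt0; rewrite ltNge tr.
Qed.

End PowerSeries.

(** * Topology of the complex numbers *)
Section ComplexTopology.
Variable R : realType.
Implicit Types (z w : R[i]).

Lemma nbhsCP (z : R[i]) (P : set R[i]) :
  nbhs z P <-> exists2 e : R, 0 < e & forall w, cmod (w - z) < e -> P w.
Proof.
split.
  move/nbhs_ballP => [e /= e0 He].
  have er : e = (complex.Re e)%:C.
    by move: e0; case: (e) => x y; rewrite ltcE /= => /andP[/eqP -> _].
  exists (complex.Re e); first by rewrite -ltcR -er.
  move=> w hw; apply: He; rewrite -ball_normE /= distrC er.
  by rewrite cmodE ltcR.
case=> e e0 He; apply/nbhs_ballP; exists e%:C; first by rewrite /= ltcR.
by move=> w; rewrite -ball_normE /= distrC cmodE ltcR => /He.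
Qed.

Lemma cmod_continuous : continuous (@cmod R).
Proof.
move=> z; apply/(@cvgrPdist_lt _ _ _ (nbhs z)) => e e0; apply/nbhsCP; exists e => // w hw.
rewrite ltr_distl; have := cmodB_ge z w; have := cmodB_ge w z.
rewrite (cmodBC z w); lra.
Qed.

Lemma horner_continuous (p : {poly R[i]}) : continuous (fun z : R[i] => p.[z]).
Proof.
elim/poly_ind: p => [|p c IH] z.
  have -> : (fun z : R[i] => (0 : {poly R[i]}).[z]) = cst 0.
    by apply/funext => w; rewrite horner0.
  exact: cst_continuous.
have -> : (fun z : R[i] => (p * 'X + c%:P).[z]) = (fun z => p.[z] * z + c).
  by apply/funext => w; rewrite hornerMXaddC.
apply: (@cvgD R[i] R[i]^o _ (nbhs z)); last exact: (@cvg_cst R[i]^o).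
by apply: (@cvgM R[i] _ (nbhs z)); [exact: IH|exact: cvg_id].
Qed.

Lemma complex_continuous : continuous (fun x : R * R => (x.1 +i* x.2 : R[i])).
Proof.
move=> x P /nbhsCP[e e0 He].
have e2 : 0 < e / 2 by rewrite divr_gt0.
exists (ball x.1 (e / 2), ball x.2 (e / 2)); first by split; exact: nbhsx_ballx.
move=> y [/= y1 y2]; apply: He.
have -> : (y.1 +i* y.2) - (x.1 +i* x.2) = (y.1 - x.1)%:C + 'i * (y.2 - x.2)%:C.
  by simpc.
apply: (le_lt_trans (cmodD _ _)); rewrite cmodM !cmodR.
have -> : cmod ('i : R[i]) = 1.
  by rewrite /cmod /= expr0n expr1n add0r sqrtr1.
rewrite mul1r; move: y1 y2; rewrite -!ball_normE /= !(distrC x.1) !(distrC x.2); lra.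
Qed.

Lemma bounded_closed_compact (K : set R[i]) (B : R) :
  closed K -> (forall z, K z -> cmod z <= B) -> compact K.
Proof.
move=> cK bK.
pose Q : set R[i] := (fun x : R * R => (x.1 +i* x.2 : R[i])) @` (`[-B, B] `*` `[-B, B]).
have cQ : compact Q.
  apply: continuous_compact.
    by apply: continuous_subspaceT => x; exact: complex_continuous.
  by apply: compact_setX; exact: segment_compact.
apply: (subclosed_compact cK cQ) => z Kz.
exists (complex.Re z, complex.Im z); last by case: z {Kz}.
have hb (x : R) : x ^+ 2 <= cmod z ^+ 2 -> x \in `[-B, B].
  rewrite -(real_normK (num_real x)) ler_pXn2r ?nnegrE ?cmod_ge0 // => h.
  by rewrite in_itv /= -ler_norml (le_trans h) // bK.
have z2 : cmod z ^+ 2 = complex.Re z ^+ 2 + complex.Im z ^+ 2.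
  by case: z {Kz hb} => x y; rewrite /cmod /= sqr_sqrtr // addr_ge0 ?sqr_ge0.
by split; apply: hb; rewrite z2 ?lerDl ?lerDr sqr_ge0.
Qed.

Lemma gap_continuous (a : nat -> R[i]) N : continuous (gap a N).
Proof.
move=> z; apply: (@cvgB _ R^o _ (nbhs z)); last first.
  exact: (continuous_comp (@cmod_continuous z) (@exprn_continuous R N (cmod z))).
apply: (@cvgM _ _ (nbhs z)).
  exact: (continuous_comp (@horner_continuous (psum a N) z) (@cmod_continuous _)).
apply: (@cvgB _ R^o _ (nbhs z)); last exact: cmod_continuous.
exact: (@cvg_cst R^o).
Qed.

Definition cball (z : R[i]) (r : R) : set R[i] := [set w | cmod (w - z) <= r].
Definition csphere (z : R[i]) (r : R) : set R[i] := [set w | cmod (w - z) = r].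

End ComplexTopology.

(** * Hurwitz theorem *)
Section Hurwitz.
Variable R : realType.
Implicit Types (a b : nat -> R[i]) (t z : R[i]).

Lemma cdist_continuous (z0 : R[i]) : continuous (fun z : R[i] => cmod (z - z0)).
Proof.
move=> z; apply: (@continuous_comp _ _ _ (fun z => z - z0) (@cmod R)); last exact: cmod_continuous.
apply: (@cvgB _ R[i]^o _ (nbhs z)); [exact: cvg_id|exact: (@cvg_cst R[i]^o)].
Qed.

Lemma cball_compact (z : R[i]) r : compact (cball z r).
Proof.
apply: (@bounded_closed_compact _ _ (r + cmod z)).
  exact: (closed_comp (fun x _ => @cdist_continuous z x) (@closed_le R r)).
by move=> w; rewrite /cball /= => wr; have := cmodB_ge w z; lra.
Qed.

Lemma csphere_compact (z : R[i]) r : compact (csphere z r).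
Proof.
apply: (@subclosed_compact _ _ (cball z r)); [|exact: cball_compact|].
  2: by move=> w; rewrite /csphere /cball /= => ->.
exact: (closed_comp (fun x _ => @cdist_continuous z x) (@closed_eq R r)).
Qed.

(** By monotonicity of the gap in N, the indices witnessing that a does not vanish
    at the points of K have a common bound. *)
Lemma gap_compact a (K : set R[i]) : sub_unit a -> compact K ->
  (forall t, K t -> cmod t <= 1) -> (forall t, K t -> ~ vanish a t) ->
  exists n mu, 0 < mu /\ forall t, K t -> mu <= gap a n t.
Proof.
move=> a1 /compact_near_coveringP cK K1 Kv.
have [] := cK nat \oo (fun m t => cmod t <= 1 -> m.+1%:R^-1 <= gap a m t) _ _.
  move=> t Kt; have /existsNP[n] := Kv t Kt; move/negP; rewrite -ltNge => gp.
  have g2 : 0 < gap a n t / 2 by rewrite divr_gt0.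
  have E1 : \forall t' \near t, gap a n t / 2 < gap a n t'.
    by apply: (cvgr_gt _ (@gap_continuous R a n t)); lra.
  have E2 : \forall m \near \oo, (n <= m)%N /\ m.+1%:R^-1 < gap a n t / 2.
    near=> m; split; first by near: m; exact: nbhs_infty_ge.
    by near: m; exact: near_infty_natSinv_lt (PosNum g2).
  exists ([set t' | gap a n t / 2 < gap a n t'],
          [set m | (n <= m)%N /\ m.+1%:R^-1 < gap a n t / 2]) => //.
  move=> [t' m] [/= h1 [nm h2]] t'1.
  apply: le_trans (gap_homo a1 t'1 nm); exact/ltW/(lt_trans h2).
move=> m _ Hm; exists m, m.+1%:R^-1; split; first by rewrite invr_gt0.
by move=> t Kt; apply: (Hm m (leqnn m) t Kt); exact: K1.
Unshelve. all: by end_near. Qed.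

(** On a small circle around t0 the gap of a is at least some mu > 0 from an index n
    on; the same holds for every b with the same first n coefficients.  At t0 the
    partial sums of b are smaller than mu if enough coefficients agree.  By the
    minimum principle they have roots inside the circle, and these have a limit point
    at which b vanishes. *)
Lemma hurwitz a t0 r : sub_unit a -> a 0%N = 1 -> cmod t0 < 1 -> vanish a t0 -> 0 < r ->
  exists N, forall b, sub_unit b -> (forall k, (k < N)%N -> b k = a k) ->
    exists t, [/\ cmod (t - t0) < r, cmod t < 1 & vanish b t].
Proof.
move=> a1 a01 t01 v r0.
have [r1 r10 Hr1] := isolated_zero a1 a01 t01.
pose rho := Num.min (r / 2) r1.
have rho0 : 0 < rho by rewrite lt_min r10 divr_gt0.
have rhor : rho < r by rewrite gt_min; apply/orP; left; lra.
have rhor1 : rho <= r1 by rewrite ge_min lexx orbT.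
have [] := gap_compact a1 (@csphere_compact t0 rho).
- by move=> t /= tr; have [|/ltW //] := Hr1 t; rewrite tr.
- move=> t /= tr vt; have [|_ /(_ vt) tt0] := Hr1 t; first by rewrite tr.
  by move: rho0; rewrite -tr tt0 subrr cmod0 ltxx.
move=> n [mu [mu0 Hmu]].
have t001 : 0 <= cmod t0 < 1 by rewrite cmod_ge0.
have mut : 0 < mu * (1 - cmod t0) / 2 by rewrite divr_gt0 // mulr_gt0 // subr_gt0.
have [N HN] := expr_small t001 mut.
exists (maxn n N) => b b1 ba.
have root M : (maxn n N <= M)%N -> exists2 z, cmod (z - t0) < rho & root (psum b M) z.
  rewrite geq_max => /andP[nM NM].
  apply: contrapT => noroot.
  have : mu <= cmod (psum b M).[t0].
    apply: (@min_modulus_center _ _ _ rho); [exact: ltW|exact: ltW| |].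
      move=> z zr; have zs : csphere t0 rho z by [].
      have z1 : cmod z < 1 by have [|] := Hr1 z; rewrite ?zr.
      apply: (le_trans (Hmu z zs)).
      have -> : gap a n z = gap b n z.
        rewrite /gap (@eq_psum _ a b) // => k kn.
        by rewrite ba // (leq_trans kn) // leq_maxl.
      apply: (le_trans (gap_homo b1 (ltW z1) nM)); rewrite /gap lerBlDr.
      rewrite (@le_trans _ _ (cmod (psum b M).[z])) // ?lerDl ?exprn_ge0 ?cmod_ge0 //.
      by rewrite ler_piMr ?cmod_ge0 // gerBl cmod_ge0.
    by move=> z zr; apply/negP => rz; apply: noroot; exists z.
  apply/negP; rewrite -ltNge.
  have t1 : 0 < 1 - cmod t0 by rewrite subr_gt0.
  rewrite -(ltr_pM2r t1).
  have h1 : cmod (psum b N).[t0] * (1 - cmod t0) <= cmod t0 ^+ N.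
    have := v N; rewrite subr_le0 (@eq_psum _ a b) // => k kN.
    by rewrite ba // (leq_trans kN) // leq_maxr.
  have h2 := psum_tail b1 NM (ltW t01).
  have h3 := HN N (leqnn N).
  have h4 : 0 <= cmod t0 ^+ M by rewrite exprn_ge0 ?cmod_ge0.
  have := ler_wpM2r (ltW t1) (cmodD ((psum b M).[t0] - (psum b N).[t0]) (psum b N).[t0]).
  rewrite subrK mulrDl; lra.
apply: contrapT => nov.
have [] := gap_compact b1 (@cball_compact t0 rho).
- by move=> t /= tr; have [|/ltW //] := Hr1 t; rewrite (le_trans tr).
- move=> t /= tr vt; apply: nov; exists t; split=> //; first exact: le_lt_trans rhor.
  by have [|] := Hr1 t; rewrite ?(le_trans tr).
move=> n' [mu' [mu'0 Hmu']].
have [z zr /rootP rz] := root (maxn (maxn n N) n') (leq_maxl _ _).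
have z1 : cmod z < 1 by have [|] := Hr1 z; rewrite // (le_trans (ltW zr)).
have := le_trans (Hmu' z (ltW zr)) (gap_homo b1 (ltW z1) (leq_maxr (maxn n N) n')).
rewrite /gap rz cmod0 mul0r sub0r.
have : 0 <= cmod z ^+ maxn (maxn n N) n' by rewrite exprn_ge0 ?cmod_ge0.
lra.
Qed.

End Hurwitz.

(** * Critical orbits and their signs *)
Section Dynamics.
Variable R : realType.
Implicit Types (c x y : R).

Lemma eta0 c x : eta c 0 x = 1.
Proof. by rewrite /eta big_ord0. Qed.

Lemma etaS c k x : eta c k.+1 x = eta c k x * Num.sg (iter k (quad c) x).
Proof. by rewrite /eta big_ord_recr. Qed.

Lemma etaD c m k x : eta c (m + k) x = eta c m x * eta c k (iter m (quad c) x).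
Proof.
elim: k => [|k IH]; first by rewrite addn0 eta0 mulr1.
by rewrite addnS !etaS IH mulrA addnC iterD.
Qed.

Lemma eq_eta c c' k x x' :
  (forall j, (j < k)%N -> Num.sg (iter j (quad c) x) = Num.sg (iter j (quad c') x')) ->
  eta c k x = eta c' k x'.
Proof. by move=> H; apply: eq_bigr => j _; exact: H. Qed.

Lemma eta_norm c k x : `|eta c k x| <= 1.
Proof.
elim: k => [|k IH]; first by rewrite eta0 normr1.
by rewrite etaS normrM normr_sg mulr_ile1 //; case: (_ == _).
Qed.

Lemma eta_sqr c k x : (forall j, (j < k)%N -> iter j (quad c) x != 0) ->
  eta c k x ^+ 2 = 1.
Proof.
elim: k => [_|k IH H]; first by rewrite eta0 expr1n.
rewrite etaS exprMn IH ?mul1r ?sqr_sg ?H //.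
by move=> j jk; rewrite H // ltnW.
Qed.

Lemma iter_bounded k (B : R) : exists2 B', 0 <= B' &
  forall c x, `|c| <= B -> `|x| <= B -> `|iter k (quad c) x| <= B'.
Proof.
elim: k => [|k [B' B'0 H]].
  exists `|B| => // c x _ xB; exact: le_trans xB (ler_norm _).
exists (B' ^+ 2 + `|B|); first by rewrite addr_ge0 ?exprn_ge0.
move=> c x cB xB; rewrite iterS /quad (le_trans (ler_normD _ _)) // lerD //.
  by rewrite normrX lerXn2r ?nnegrE // H.
exact: le_trans cB (ler_norm _).
Qed.

Lemma iter_lipschitz k (B : R) : exists2 M, 0 <= M &
  forall c c' x x', `|c| <= B -> `|c'| <= B -> `|x| <= B -> `|x'| <= B ->
    `|iter k (quad c) x - iter k (quad c') x'| <= M * (`|c - c'| + `|x - x'|).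
Proof.
elim: k => [|k [M M0 H]].
  by exists 1 => // c c' x x' _ _ _ _; rewrite mul1r lerDr.
have [B' B'0 HB] := iter_bounded k B.
exists (2 * B' * M + 1); first by rewrite addr_ge0 // !mulr_ge0.
move=> c c' x x' hc hc' hx hx'; rewrite !iterS /quad.
set u := iter k (quad c) x; set v := iter k (quad c') x'.
have -> : u ^+ 2 + c - (v ^+ 2 + c') = (u - v) * (u + v) + (c - c') by ring.
rewrite (le_trans (ler_normD _ _)) // normrM.
have h1 := H _ _ _ _ hc hc' hx hx'; rewrite -/u -/v in h1.
have h2 : `|u + v| <= 2 * B'.
  by rewrite (le_trans (ler_normD _ _)) // mulr_natl mulr2n lerD // HB.
have := ler_pM (normr_ge0 _) (normr_ge0 _) h1 h2.
have := normr_ge0 (x - x'); nra.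
Qed.

Lemma sg_close (a b : R) : `|a - b| < `|b| -> Num.sg a = Num.sg b.
Proof.
have [b0|b0|->] := ltrgt0P b; last by rewrite ltNge normr_ge0.
- by rewrite ltr_norml => /andP[h1 h2]; rewrite !gtr0_sg //; lra.
- by rewrite ltr_norml => /andP[h1 h2]; rewrite !ltr0_sg //; lra.
Qed.

Lemma sg_orb_near c0 n : (forall k, (k < n)%N -> orb c0 k != 0) ->
  exists2 d, 0 < d & forall c y k, `|c - c0| < d -> `|y| < d -> (k < n)%N ->
    Num.sg (iter k (quad c) (c + y)) = Num.sg (orb c0 k).
Proof.
elim: n => [_|n IH H]; first by exists 1.
have [|d d0 Hd] := IH; first by move=> k kn; rewrite H // ltnW.
have [M M0 HM] := iter_lipschitz n (`|c0| + 2).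
have on0 : 0 < `|orb c0 n| by rewrite normr_gt0 H.
exists (Num.min (Num.min d 1) (`|orb c0 n| / (3 * M + 1))).
  by rewrite !lt_min d0 ltr01 /= divr_gt0 // ltr_wpDl // mulr_ge0.
move=> c y k; rewrite !lt_min => /andP[/andP[cd c1] cM] /andP[/andP[yd y1] yM].
rewrite ltnS leq_eqVlt => /predU1P[->|]; last exact: Hd.
apply: sg_close.
have cc : `|c| <= `|c0| + 1.
  by rewrite -(subrK c0 c) (le_trans (ler_normD _ _)) // addrC lerD2l ltW.
have ccy : `|c + y| <= `|c0| + 2.
  by rewrite (le_trans (ler_normD _ _)) //; lra.
have c0p := normr_ge0 c0.
have cc2 : `|c| <= `|c0| + 2 by lra.
have cc02 : `|c0| <= `|c0| + 2 by lra.
apply: (le_lt_trans (HM c c0 (c + y) c0 cc2 cc02 ccy cc02)).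
have -> : c + y - c0 = (c - c0) + y by ring.
have M3 : 0 < 3 * M + 1 by rewrite ltr_wpDl // mulr_ge0.
move: cM yM; rewrite !ltr_pdivlMr // => cM yM.
have := ler_normD (c - c0) y; have := normr_ge0 (c - c0); have := normr_ge0 y.
nra.
Qed.

Lemma orb_near c0 k (e : R) : 0 < e -> exists2 d, 0 < d &
  forall c, `|c - c0| < d -> `|orb c k - orb c0 k| < e.
Proof.
move=> e0; have [M M0 HM] := iter_lipschitz k (`|c0| + 1).
exists (Num.min 1 (e / (2 * M + 1))).
  by rewrite lt_min ltr01 /= divr_gt0 // ltr_wpDl // mulr_ge0.
move=> c; rewrite lt_min => /andP[c1 ce].
have cc : `|c| <= `|c0| + 1.
  by rewrite -(subrK c0 c) (le_trans (ler_normD _ _)) // addrC lerD2l ltW.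
have cc0 : `|c0| <= `|c0| + 1 by rewrite lerDl.
apply: (le_lt_trans (HM _ _ _ _ cc cc0 cc cc0)).
have M3 : 0 < 2 * M + 1 by rewrite ltr_wpDl // mulr_ge0.
move: ce; rewrite ltr_pdivlMr //; have := normr_ge0 (c - c0); nra.
Qed.

Lemma period_orb c p : zero_period c p ->
  exists m, [/\ p = m.+1, orb c m = 0 & forall k, (k < m)%N -> orb c k != 0].
Proof.
have o k : orb c k = iter k.+1 (quad c) 0 by rewrite iterSr /quad expr0n add0r.
case: p => [|m] [// _ p0 H]; exists m; split=> //; first by rewrite o.
by move=> k km; apply/eqP; rewrite o; apply: H; rewrite ltnS.
Qed.

Lemma zero_periodic_period c : zero_periodic c -> exists p, zero_period c p.
Proof.
case=> p p0 hp.
pose P n := (0 < n)%N && (iter n (quad c) 0 == 0).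
have exP : exists n, P n by exists p; rewrite /P p0 hp eqxx.
have [n /andP[n0 /eqP hn] Hmin] := ex_minnP exP.
exists n; split => // q /andP[q0 qn] hq.
by have := Hmin q; rewrite /P q0 hq eqxx => /(_ isT); rewrite leqNgt qn.
Qed.

Lemma not_periodic_orb c k : ~ zero_periodic c -> orb c k != 0.
Proof.
move=> np; apply/eqP => h; apply: np; exists k.+1 => //.
by rewrite iterSr /quad expr0n add0r.
Qed.

(** Let p = m + 1 and u = f_c^m(c), which is close to 0.  One turn sends c + y to
    c + v^2 with v = f_c^m(c + y).  If |y| <= 4 |u|^2 then v differs from u by
    O(|u|^2), hence by at most |u| / 2, hence v^2 <= 4 |u|^2: this repeats for ever, and
    all returns v to the neighbourhood of 0 have the sign of u. *)
Lemma superattracting_near c0 p : zero_period c0 p ->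
  exists2 d, 0 < d & forall c, `|c - c0| < d ->
    (forall k, (k < p)%N -> eta c k c = eta c0 k c0) /\
    (forall k, Num.sg (orb c (k + p)) = Num.sg (orb c k)).
Proof.
move=> /period_orb[m [-> om0 on0]].
have [d1' d1'0 Hd1'] := sg_orb_near on0.
pose d1 := Num.min d1' 1.
have d10 : 0 < d1 by rewrite lt_min d1'0 /=.
have d11 : d1 <= 1 by rewrite ge_min lexx orbT.
have d1d : d1 <= d1' by rewrite ge_min lexx.
have [M0 M00 HM0] := iter_lipschitz m (`|c0| + 2).
pose M := M0 + 1.
have M1 : 1 <= M by rewrite lerDr.
have Mp : 0 < M by exact: lt_le_trans M1.
have c0p := normr_ge0 c0.
(* small enough for 4 M |u|^2 <= |u| / 2 and 4 |u|^2 < d1 when |u| < e *)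
pose e := d1 / (8 * M).
have e0 : 0 < e by rewrite divr_gt0 // mulr_gt0.
have eM : e * (8 * M) = d1 by rewrite divfK // gt_eqF // mulr_gt0.
have [d2 d20 Hd2] := orb_near c0 m e0.
exists (Num.min d1 d2); first by rewrite lt_min d10.
move=> c; rewrite lt_min => /andP[cd1 cd2].
set u := orb c m.
have ue : `|u| < e by have := Hd2 c cd2; rewrite om0 subr0.
have u0 := normr_ge0 u.
have cc : `|c| <= `|c0| + 1.
  by rewrite -(subrK c0 c) (le_trans (ler_normD _ _)) // addrC lerD2l; lra.
have u2d : 4 * `|u| ^+ 2 < d1 by nra.
have V y : `|y| <= 4 * `|u| ^+ 2 -> `|iter m (quad c) (c + y) - u| <= `|u| / 2.
  move=> hy; have ccy : `|c + y| <= `|c0| + 2.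
    by rewrite (le_trans (ler_normD _ _)) //; lra.
  have cc2 : `|c| <= `|c0| + 2 by lra.
  apply: (le_trans (HM0 c c (c + y) c cc2 cc2 ccy cc2)).
  have -> : c + y - c = y by ring.
  rewrite subrr normr0 add0r.
  have h1 : M0 * `|y| <= M * (4 * `|u| ^+ 2).
    by apply: ler_pM => //; rewrite lerDl.
  nra.
have S j : exists y, `|y| <= 4 * `|u| ^+ 2 /\ orb c (j * m.+1) = c + y.
  elim: j => [|j [y [hy oy]]].
    by exists 0; rewrite normr0 mul0n /= addr0; split=> //; rewrite mulr_ge0 ?exprn_ge0.
  exists (iter m (quad c) (c + y) ^+ 2); split.
    have vu := V y hy; set v := iter _ _ _ in vu *.
    have vle : `|v| <= 2 * `|u|.
      by have := ler_normD (v - u) u; rewrite subrK; lra.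
    rewrite normrX; have := normr_ge0 v; nra.
  by rewrite mulSn addSn iterS iterD oy /quad addrC.
have sgi j i : (i < m)%N -> Num.sg (orb c (j * m.+1 + i)) = Num.sg (orb c0 i).
  move=> im; rewrite addnC iterD; have [y [hy ->]] := S j.
  by apply: Hd1' => //; lra.
have sgm j : Num.sg (orb c (j * m.+1 + m)) = Num.sg u.
  rewrite addnC iterD; have [y [/V hy ->]] := S j.
  have [u00|u00] := eqVneq u 0.
    by move: hy; rewrite u00 normr0 mul0r normr_le0 subr0 => /eqP ->.
  apply: sg_close; apply: le_lt_trans hy _.
  by rewrite -normr_gt0 in u00; lra.
split=> [k kp|k].
  apply: eq_eta => j jk; apply: (sgi 0%N); rewrite -ltnS.
  exact: leq_ltn_trans jk kp.
have -> : (k + m.+1 = (k %/ m.+1).+1 * m.+1 + k %% m.+1)%N.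
  by rewrite {1}(divn_eq k m.+1) mulSn addnC addnA.
rewrite [in RHS](divn_eq k m.+1).
have : (k %% m.+1 <= m)%N by rewrite -ltnS ltn_pmod.
by rewrite leq_eqVlt => /predU1P[->|km]; rewrite ?sgm ?sgi.
Qed.

(** By the chain rule f_c^m is monotone to the right of c, in the direction given by
    the sign of its derivative, which is eta_m(c). *)
Lemma right_monotone c m : (forall k, (k < m)%N -> orb c k != 0) ->
  exists2 d, 0 < d & forall x, c < x < c + d ->
    (forall k, (k < m)%N -> Num.sg (iter k (quad c) x) = Num.sg (orb c k)) /\
    Num.sg (iter m (quad c) x - orb c m) = eta c m c.
Proof.
elim: m => [_|m IH on0].
  by exists 1 => // x /andP[cx _]; split=> //=; rewrite eta0 gtr0_sg // subr_gt0.
have [|d d0 Hd] := IH; first by move=> k km; rewrite on0 // ltnW.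
have [d' d'0 Hd'] := sg_orb_near on0.
have [M M0 HM] := iter_lipschitz m (`|c| + 1).
have om : 0 < `|orb c m| by rewrite normr_gt0 on0.
have c0p := normr_ge0 c.
have M1 : 0 < M + 1 by rewrite ltr_wpDl.
exists (Num.min (Num.min d d') (Num.min 1 (`|orb c m| / (M + 1)))).
  by rewrite !lt_min d0 d'0 ltr01 divr_gt0.
move=> x /andP[cx]; rewrite -ltrBlDl !lt_min => /andP[/andP[xd xd'] /andP[x1 xM]].
have xc0 : 0 < x - c by rewrite subr_gt0.
have [|H1 H2] := Hd x; first by rewrite cx -ltrBlDl.
have nx : `|x - c| = x - c by rewrite gtr0_norm.
have sgx k : (k < m.+1)%N -> Num.sg (iter k (quad c) x) = Num.sg (orb c k).
  by move=> km; rewrite -(Hd' c (x - c) k) ?subrr ?normr0 ?nx // addrC subrK.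
split=> //; rewrite !iterS /quad etaS -H2.
set u := iter m (quad c) x; set v := orb c m.
have -> : u ^+ 2 + c - (v ^+ 2 + c) = (u - v) * (u + v) by ring.
rewrite sgrM; congr (_ * _).
have -> : Num.sg v = Num.sg (v + v).
  by rewrite -mulr2n -mulr_natl sgrM (@gtr0_sg _ 2) // mul1r.
apply: sg_close; have -> : u + v - (v + v) = u - v by ring.
have xc : `|x| <= `|c| + 1.
  by rewrite -(subrK c x) (le_trans (ler_normD _ _)) // addrC lerD2l nx ltW.
have cc : `|c| <= `|c| + 1 by rewrite lerDl.
apply: (le_lt_trans (HM c c x c cc cc xc cc)).
rewrite subrr normr0 add0r nx -mulr2n -mulr_natl normrM ger0_norm //.
by move: xM; rewrite ltr_pdivlMr // -/v; nra.
Qed.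

(** Since f_c^(m+1)(x) - c is the square of f_c^m(x), a point close to c on its right
    returns to the right of c, and closer to it.  So its orbit never meets 0 and its
    signs repeat.  The sign of f_c^m(x) is eta_m(c), and hence eta_(m+1)(x) = 1. *)
Lemma right_basin c m : orb c m = 0 -> (forall k, (k < m)%N -> orb c k != 0) ->
  exists2 d, 0 < d & forall x, c < x < c + d ->
    orbit_avoids0 c x /\ forall k, eta c k x = eta c (k %% m.+1) c.
Proof.
move=> om on0.
have [d d0 Hd] := right_monotone on0.
have [M M0 HM] := iter_lipschitz m (`|c| + 1).
have M1 : 0 < M + 1 by rewrite ltr_wpDl.
pose d' := Num.min d (Num.min 1 ((M + 1) ^+ 2)^-1).
have d'0 : 0 < d' by rewrite !lt_min d0 ltr01 invr_gt0 exprn_gt0.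
have d'd : d' <= d by rewrite ge_min lexx.
have d'1 : d' <= 1 by rewrite !ge_min lexx orbT.
have d'M : d' * (M + 1) ^+ 2 <= 1.
  by rewrite -ler_pdivlMr ?exprn_gt0 // mul1r /d' !ge_min lexx !orbT.
have c0p := normr_ge0 c.
have turn x : c < x < c + d' -> [/\ c < iter m.+1 (quad c) x < c + d',
    forall k, (k <= m)%N -> iter k (quad c) x != 0,
    forall k, (k <= m)%N -> eta c k x = eta c k c & eta c m.+1 x = 1].
  case/andP => cx xd'.
  have [|H1 H2] := Hd x; first by rewrite cx /=; lra.
  rewrite om subr0 in H2.
  have s2 := eta_sqr on0.
  have e1 k : (k <= m)%N -> eta c k x = eta c k c.
    by move=> km; apply: eq_eta => j jk; rewrite H1 // (leq_trans jk).
  have um0 : iter m (quad c) x != 0.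
    rewrite -sgr_eq0 H2; apply/eqP => h; move: s2; rewrite h expr0n /= => /eqP.
    by rewrite eq_sym oner_eq0.
  split=> //.
  - rewrite iterS /quad addrC ltrDl ltrD2l exprn_even_gt0 //= um0 /=.
    have xc : `|x| <= `|c| + 1.
      by have := ler_normD (x - c) c; rewrite subrK (gtr0_norm (_ : 0 < x - c)); lra.
    have cc : `|c| <= `|c| + 1 by rewrite lerDl.
    have := HM c c x c cc cc xc cc; rewrite om subr0 subrr normr0 add0r.
    rewrite (gtr0_norm (_ : 0 < x - c)); last by lra.
    rewrite -(real_normK (num_real (iter m _ _))).
    have := normr_ge0 (iter m (quad c) x); set u := `|_| => u0 uM.
    have h1 : u <= (M + 1) * (x - c) by nra.
    have h2 : u ^+ 2 <= ((M + 1) * (x - c)) ^+ 2.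
      by rewrite lerXn2r ?nnegrE // mulr_ge0 //; lra.
    rewrite exprMn in h2.
    have h3 : 0 <= (M + 1) ^+ 2 by rewrite exprn_ge0 // ltW.
    apply: (le_lt_trans h2).
    have : (M + 1) ^+ 2 * (x - c) <= (M + 1) ^+ 2 * d' by rewrite ler_wpM2l //; lra.
    nra.
  - by move=> k; rewrite leq_eqVlt => /predU1P[->//|km]; rewrite -sgr_eq0 H1 // sgr_eq0 on0.
  - by rewrite etaS e1 // H2 -expr2.
exists d' => // x xd.
have T j : c < iter (j * m.+1) (quad c) x < c + d'.
  elim: j => [|j IH] //; rewrite mulSn iterD.
  by have [] := turn _ IH.
split.
  move=> n; rewrite (divn_eq n m.+1) addnC iterD.
  by have [_ + _ _] := turn _ (T (n %/ m.+1)%N); apply; rewrite -ltnS ltn_pmod.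
move=> k; rewrite [in LHS](divn_eq k m.+1) etaD.
have km : (k %% m.+1 <= m)%N by rewrite -ltnS ltn_pmod.
have [_ _ /(_ _ km) -> _] := turn _ (T (k %/ m.+1)%N).
suff -> : eta c (k %/ m.+1 * m.+1) x = 1 by rewrite mul1r.
elim: (k %/ m.+1)%N => [|j IH]; first by rewrite mul0n eta0.
rewrite mulSn addnC etaD IH mul1r.
by have [] := turn _ (T j).
Qed.

End Dynamics.

(** * Kneading zeros in the unit disc *)
Section KneadingZeros.
Variable R : realType.
Implicit Types (c x y : R) (t : R[i]).

(** Past the period of a superattracting c these vanish, because eta then contains
    the sign of 0: the series is the numerator P of K_c. *)
Definition kcoef c k : R[i] := (eta c k c)%:C.

Lemma kcoef_sub_unit c : sub_unit (kcoef c).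
Proof. by move=> k; rewrite /kcoef cmodR eta_norm. Qed.

Lemma kcoef0 c : kcoef c 0 = 1.
Proof. by rewrite /kcoef eta0. Qed.

Lemma zero_period_periodic c p : zero_period c p -> zero_periodic c.
Proof. by case=> p0 hp _; exists p. Qed.

(** By [right_basin] the orbits starting just to the right of c avoid 0, so the
    filter of the limit is proper, and eta is constant along it. *)
Lemma kneading_coefE c p k : zero_period c p -> kneading_coef c k = eta c (k %% p) c.
Proof.
move=> zp; have [m [-> om on0]] := period_orb zp.
rewrite /kneading_coef asboolT; last exact: zero_period_periodic zp.
have [d d0 Hd] := right_basin om on0.
have near_right : \forall x \near c^'+, c < x < c + d.
  near=> x; apply/andP; split; near: x; first exact: nbhs_right_gt.
  by apply: nbhs_right_lt; rewrite ltrDl.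
have PF : ProperFilter (within (orbit_avoids0 c) c^'+).
  apply: Build_ProperFilter_ex => P HP.
  have [x [xd Px]] := @filter_ex _ c^'+ _ _ (filterI near_right HP).
  by exists x; apply: Px; have [] := Hd x xd.
apply: cvg_lim; first exact: Rhausdorff.
apply: cvg_near_cst.
have : \forall x \near c^'+, eta c k x = eta c (k %% m.+1) c.
  by apply: filterS near_right => x /Hd[_ ->].
exact: cvg_within.
Unshelve. all: by end_near. Qed.

Lemma eta_period c p k : zero_period c p -> (p <= k)%N -> eta c k c = 0.
Proof.
move=> /period_orb[m [-> om _]] mk.
have -> : k = (m.+1 + (k - m.+1))%N by rewrite subnKC.
by rewrite etaD etaS om sgr0 mulr0 mul0r.
Qed.

Lemma kneading_ratfun_iff c p (F : {fraction {poly R[i]}}) : zero_period c p ->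
  is_kneading_ratfun c F <->
  F = (tofrac (psum (kcoef c) p) / tofrac (1 - 'X^p))%R.
Proof.
move=> zp.
have main n : \sum_(j < n.+1) (1 - 'X^p : {poly R[i]})`_j * (kneading_coef c (n - j))%:C
    = (psum (kcoef c) p)`_n.
  under eq_bigr => j _ do rewrite coefB coef1 coefXn mulrBl (kneading_coefE _ zp).
  rewrite sumrB big_ord_recl /= mul1r subn0 big1 ?addr0; last first.
    by move=> j _; rewrite mul0r.
  have p0 : (0 < p)%N by case: zp.
  rewrite /psum coef_poly; case: (ltnP n p) => [np|pn].
    rewrite big1 ?subr0 ?modn_small // => j _.
    by rewrite ltn_eqF ?mul0r // (leq_ltn_trans _ np) // -ltnS.
  have jp : (p < n.+1)%N by [].
  rewrite (bigD1 (Ordinal jp)) //= eqxx mul1r big1 ?addr0.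
    by rewrite -{1}(subnK pn) modnDr subrr.
  by move=> j jneq; rewrite -(inj_eq val_inj) /= in jneq; rewrite (negbTE jneq) mul0r.
split.
  case=> q [P [zq PE ->]].
  have qp : q = p.
    case: zq zp => q0 hq mq [p0 hp mp]; apply/eqP; rewrite eqn_leq; apply/andP; split.
      by rewrite leqNgt; apply/negP => pq; apply: (mq p); rewrite ?p0.
    by rewrite leqNgt; apply/negP => pq; apply: (mp q); rewrite ?q0.
  subst q; congr (tofrac _ / _); apply/polyP => n; rewrite PE; exact: main.
by move=> ->; exists p, (psum (kcoef c) p); split => // n; rewrite main.
Qed.

(** Where 1 - X^p does not vanish, cancelling common factors does not affect
    whether t is a root. *)
Lemma kneading_root c p t : zero_period c p -> t ^+ p != 1 ->
  (exists F, is_kneading_ratfun c F /\ ratfun_root F t) <-> root (psum (kcoef c) p) t.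
Proof.
move=> zp tp; have X0 : (1 - 'X^p : {poly R[i]}).[t] != 0.
  by rewrite !hornerE subr_eq0 eq_sym.
have Xn0 : (1 - 'X^p : {poly R[i]}) != 0 by apply: contraNneq X0 => ->; rewrite horner0.
split.
  case=> F [/(kneading_ratfun_iff _ zp) -> [A [B [AB B0 A0]]]].
  have Bn0 : B != 0 by apply: contraNneq B0 => ->; rewrite horner0.
  have PB : psum (kcoef c) p * B = A * (1 - 'X^p).
    apply/eqP; rewrite -tofrac_eq !tofracM -eqr_div ?tofrac_eq0 //; exact/eqP.
  have := congr1 (fun q => q.[t]) PB; rewrite !hornerM A0 mul0r => /eqP.
  by rewrite mulf_eq0 (negbTE B0) orbF.
move=> /rootP rt; exists (tofrac (psum (kcoef c) p) / tofrac (1 - 'X^p)); split.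
  exact/(kneading_ratfun_iff _ zp).
by exists (psum (kcoef c) p), (1 - 'X^p).
Qed.

Lemma expr_neq1 t p : (0 < p)%N -> cmod t < 1 -> t ^+ p != 1.
Proof.
move=> p0; apply: contraTneq => h; rewrite -leNgt.
by rewrite -(@ler_pXn2r _ p) ?nnegrE ?cmod_ge0 // -cmodX h cmod1 expr1n.
Qed.

Lemma psum_shift (a : nat -> R[i]) (s : R[i]) p N t : (forall k, a (k + p)%N = s * a k) ->
  (psum a (N + p)).[t] = (psum a p).[t] + s * t ^+ p * (psum a N).[t].
Proof.
move=> H; elim: N => [|N IH]; first by rewrite add0n psum0 mulr0 addr0.
by rewrite addSn !psumS IH H exprD; ring.
Qed.

(** The series f satisfies f = P + s t^p f with P its first p terms, that is
    f = P / (1 - s t^p), and |s t^p| < 1. *)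
Lemma vanish_twisted_period (a : nat -> R[i]) (s : R[i]) p t : sub_unit a -> (0 < p)%N ->
  cmod s <= 1 -> cmod t < 1 -> (forall k, a (k + p)%N = s * a k) ->
  vanish a t <-> root (psum a p) t.
Proof.
move=> a1 p0 s1 t1 H; split => [v|/rootP rt N].
  apply/rootP/eqP; rewrite -cmod_eq0 eq_le cmod_ge0 andbT leNgt; apply/negP => Pp.
  have [C HC] := vanish_geom t1 v.
  have D0 : 0 < 2 * (`|C| + 1) by rewrite mulr_gt0 // ltr_wpDl.
  have t01 : 0 <= cmod t < 1 by rewrite cmod_ge0.
  have [N HN] := expr_small t01 (divr_gt0 Pp D0).
  have := HN N (leqnn N); rewrite ltr_pdivlMr //.
  have h1 := HC N; have h2 := HC (N + p)%N.
  have tN : 0 <= cmod t ^+ N by rewrite exprn_ge0 ?cmod_ge0.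
  have tNp : cmod t ^+ (N + p) <= cmod t ^+ N.
    by rewrite exprD ler_piMr // exprn_ile1 ?cmod_ge0 // ltW.
  have tp : 0 <= cmod t ^+ (N + p) by rewrite exprn_ge0 ?cmod_ge0.
  have h3 : cmod (s * t ^+ p * (psum a N).[t]) <= cmod (psum a N).[t].
    rewrite cmodM ler_piMl ?cmod_ge0 // cmodM mulr_ile1 ?cmod_ge0 // cmodX.
    by rewrite exprn_ile1 ?cmod_ge0 // ltW.
  have := cmodB_le (psum a (N + p)).[t] (s * t ^+ p * (psum a N).[t]).
  rewrite (psum_shift _ _ H) addrK -(psum_shift _ _ H) => h4.
  have := ler_norm C; have := normr_ge0 C.
  nra.
have Z j : (psum a (j * p)).[t] = 0.
  elim: j => [|j IH]; first by rewrite mul0n psum0.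
  by rewrite mulSn addnC (psum_shift _ _ H) rt IH mulr0 addr0.
apply: (@le_trans _ _ (gap a (N * p) t)).
  by apply: gap_homo => //; [exact: ltW|rewrite leq_pmulr].
by rewrite /gap Z cmod0 mul0r sub0r oppr_le0 exprn_ge0 ?cmod_ge0.
Qed.

Lemma vanish_period c p t : zero_period c p -> cmod t < 1 ->
  vanish (kcoef c) t <-> root (psum (kcoef c) p) t.
Proof.
move=> zp t1; have p0 : (0 < p)%N by case: zp.
apply: (@vanish_twisted_period _ 0) => //; [exact: kcoef_sub_unit|by rewrite cmod0|].
by move=> k; rewrite mul0r /kcoef (eta_period zp) ?leq_addl.
Qed.

(** At c0 the coefficients satisfy a_(k+p) = 0, and near c0 they satisfy
    a_(k+p) = eta_p(c) a_k with the same first p terms. *)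
Lemma vanish_near_period c0 p : zero_period c0 p -> exists2 d, 0 < d &
  forall c t, `|c - c0| < d -> cmod t < 1 ->
    vanish (kcoef c) t <-> vanish (kcoef c0) t.
Proof.
move=> zp; have [d d0 Hd] := superattracting_near zp.
have p0 : (0 < p)%N by case: zp.
exists d => // c t /Hd[H1 H2] t1.
apply: iff_trans (iff_sym (vanish_period zp t1)).
have -> : psum (kcoef c0) p = psum (kcoef c) p.
  by apply: eq_psum => k kp; rewrite /kcoef H1.
apply: (@vanish_twisted_period _ (kcoef c p)) => //; try exact: kcoef_sub_unit.
move=> k; rewrite /kcoef -rmorphM /= addnC etaD; congr (_ * _)%:C.
by apply: eq_eta => j jk; rewrite -iterD H2.
Qed.

Lemma kcoef_near c0 n : ~ zero_periodic c0 -> exists2 d, 0 < d &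
  forall c k, `|c - c0| < d -> (k < n)%N -> kcoef c k = kcoef c0 k.
Proof.
move=> np; have [d d0 Hd] := @sg_orb_near R c0 n (fun k _ => not_periodic_orb k np).
exists d => // c k cd kn; rewrite /kcoef; congr _%:C; apply: eq_eta => j jk.
have := Hd c 0 j cd; rewrite normr0 addr0; apply => //; exact: ltn_trans kn.
Qed.

Lemma nonvanish_near c0 t0 : cmod t0 < 1 -> ~ vanish (kcoef c0) t0 ->
  exists2 d, 0 < d & forall c t, `|c - c0| < d -> cmod (t - t0) < d ->
    cmod t < 1 /\ ~ vanish (kcoef c) t.
Proof.
move=> t01 nv.
have /existsNP[n] := nv; move/negP; rewrite -ltNge => gp.
have /nbhsCP[e e0 He] : \forall t \near t0, 0 < gap (kcoef c0) n t.
  exact: (cvgr_gt _ (@gap_continuous R (kcoef c0) n t0)).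
have t1 t : cmod (t - t0) < 1 - cmod t0 -> cmod t < 1.
  by have := cmodB_ge t t0; lra.
have e2 : 0 < Num.min e (1 - cmod t0) by rewrite lt_min e0 subr_gt0.
have nv0 t : cmod (t - t0) < Num.min e (1 - cmod t0) -> cmod t < 1 /\ 0 < gap (kcoef c0) n t.
  by rewrite lt_min => /andP[/He ? /t1].
have [zp|np] := pselect (zero_periodic c0).
  have [p {}zp] := zero_periodic_period zp.
  have [d d0 Hd] := vanish_near_period zp.
  exists (Num.min d (Num.min e (1 - cmod t0))); first by rewrite lt_min d0.
  move=> c t; rewrite lt_min => /andP[cd _]; rewrite lt_min => /andP[_ /nv0[t1' g]].
  by split=> // /(Hd _ _ cd t1') /(_ n); rewrite leNgt g.
have [d d0 Hd] := kcoef_near n np.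
exists (Num.min d (Num.min e (1 - cmod t0))); first by rewrite lt_min d0.
move=> c t; rewrite lt_min => /andP[cd _]; rewrite lt_min => /andP[_ /nv0[t1' g]].
split=> // /(_ n); rewrite leNgt /gap (@eq_psum _ _ (kcoef c0)).
  by rewrite -/(gap _ _ _) g.
by move=> k kn; exact: Hd.
Qed.

Lemma vanish_persists c0 t0 r : cmod t0 < 1 -> vanish (kcoef c0) t0 -> 0 < r ->
  exists2 d, 0 < d & forall c, `|c - c0| < d ->
    exists t, [/\ cmod (t - t0) < r, cmod t < 1 & vanish (kcoef c) t].
Proof.
move=> t01 v r0.
have [zp|np] := pselect (zero_periodic c0).
  have [p {}zp] := zero_periodic_period zp.
  have [d d0 Hd] := vanish_near_period zp.
  exists d => // c cd; exists t0; rewrite subrr cmod0; split=> //.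
  exact/(Hd _ _ cd t01).
have [N HN] := hurwitz (@kcoef_sub_unit c0) (kcoef0 c0) t01 v r0.
have [d d0 Hd] := kcoef_near N np.
exists d => // c cd; apply: HN; first exact: kcoef_sub_unit.
by move=> k kN; exact: Hd.
Qed.

End KneadingZeros.

(** * Kneading zeros outside the unit circle *)
Section Spectrum.
Variable R : realType.
Implicit Types (c : R) (s : R[i]).

(** For 1 < |s|: the value 1/s is a zero of K_c. *)
Definition kneading_zero c s := vanish (kcoef c) s^-1.

Lemma cmodV_lt1 s : 1 < cmod s -> cmod s^-1 < 1.
Proof. by move=> s1; rewrite cmodV invf_lt1 // (lt_trans ltr01). Qed.

Lemma inv_close s s0 : 1 <= cmod s -> 1 <= cmod s0 ->
  cmod (s^-1 - s0^-1) <= cmod (s - s0).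
Proof.
move=> s1 s01.
have sn0 : s != 0 by rewrite -cmod_gt0; exact: lt_le_trans s1.
have s0n0 : s0 != 0 by rewrite -cmod_gt0; exact: lt_le_trans s01.
have -> : s^-1 - s0^-1 = (s0 - s) * (s * s0)^-1 by field; rewrite sn0 s0n0.
rewrite cmodM cmodBC cmodV cmodM ler_piMr ?cmod_ge0 // invf_le1.
  by rewrite -[leLHS]mulr1 ler_pM.
by rewrite mulr_gt0 // (lt_le_trans ltr01).
Qed.

Lemma cmod_gt1_near s0 : 1 < cmod s0 -> forall s, cmod (s - s0) < cmod s0 - 1 -> 1 < cmod s.
Proof. by move=> s01 s h; have := cmodB_ge s0 s; rewrite cmodBC; lra. Qed.

Lemma kneading_nonzero_near c0 s0 : 1 < cmod s0 -> ~ kneading_zero c0 s0 ->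
  exists2 d, 0 < d & forall c s, `|c - c0| < d -> cmod (s - s0) < d -> ~ kneading_zero c s.
Proof.
move=> s01 nz; have [d d0 Hd] := nonvanish_near (cmodV_lt1 s01) nz.
exists (Num.min d (cmod s0 - 1)); first by rewrite lt_min d0 subr_gt0.
move=> c s; rewrite !lt_min => /andP[cd _] /andP[sd s1].
have [|_ //] := Hd c s^-1 cd.
have s1' := cmod_gt1_near s01 s1.
by apply: le_lt_trans (inv_close (ltW s1') (ltW s01)) _.
Qed.

Lemma kneading_zero_persists c0 s0 r : 1 < cmod s0 -> kneading_zero c0 s0 -> 0 < r ->
  exists2 d, 0 < d & forall c, `|c - c0| < d ->
    exists s, [/\ cmod (s - s0) < r, 1 < cmod s & kneading_zero c s].
Proof.
move=> s01 z r0; set t0 := s0^-1.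
have s0n0 : s0 != 0 by rewrite -cmod_gt0; exact: lt_trans s01.
have t00 : 0 < cmod t0 by rewrite cmod_gt0 invr_eq0.
have r'0 : 0 < Num.min (cmod t0 / 2) (r * cmod t0 ^+ 2 / 2).
  by rewrite lt_min !divr_gt0 // mulr_gt0 // exprn_gt0.
have [d d0 Hd] := vanish_persists (cmodV_lt1 s01) z r'0.
exists d => // c /Hd[t [+ t1 v]]; rewrite lt_min => /andP[tt tr].
have tt2 : cmod t0 / 2 < cmod t by have := cmodB_ge t0 t; rewrite cmodBC; lra.
have tp : 0 < cmod t by apply: lt_trans tt2; rewrite divr_gt0.
have tn0 : t != 0 by rewrite -cmod_gt0.
exists t^-1; split; last by rewrite /kneading_zero invrK.
- have -> : t^-1 - s0 = (t0 - t) * (t * t0)^-1 by rewrite /t0; field; rewrite s0n0 tn0.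
  rewrite cmodM cmodBC cmodV cmodM ltr_pdivrMr ?mulr_gt0 //.
  apply: (lt_le_trans tr).
  have : 0 <= r * cmod t0 * (cmod t - cmod t0 / 2).
    by rewrite !mulr_ge0 ?subr_ge0 // ltW.
  lra.
- by rewrite cmodV invf_gt1.
Qed.

Lemma kneading_zero_isolated c0 s0 : 1 < cmod s0 -> exists2 r, 0 < r &
  forall s, cmod (s - s0) <= r -> 1 < cmod s /\ (kneading_zero c0 s -> s = s0).
Proof.
move=> s01.
have [r r0 Hr] := isolated_zero (@kcoef_sub_unit R c0) (kcoef0 c0) (cmodV_lt1 s01).
exists (Num.min r ((cmod s0 - 1) / 2)); first by rewrite lt_min r0 divr_gt0 ?subr_gt0.
move=> s; rewrite le_min => /andP[sr s1].
have s1' : 1 < cmod s by apply: (cmod_gt1_near s01); lra.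
have [_ h] := Hr _ (le_trans (inv_close (ltW s1') (ltW s01)) sr).
by split=> // /h; exact: invr_inj.
Qed.

Lemma zero_period_0 : zero_period (0 : R) 1.
Proof. by split=> //=; [rewrite /quad expr0n addr0|case]. Qed.

Lemma kneading_zero_0 s : 1 < cmod s -> ~ kneading_zero 0 s.
Proof.
move=> s1 /(vanish_period zero_period_0 (cmodV_lt1 s1)).
by rewrite /root psumS psum0 kcoef0 expr0 mulr1 add0r oner_eq0.
Qed.

Lemma kneading_zero_bounded c s : 1 < cmod s -> kneading_zero c s -> cmod s <= 2.
Proof.
(* the first partial sum 1 gives 1 - |t| <= |t| for t = 1/s *)
move=> s1 /(_ 1%N); rewrite /gap psumS psum0 kcoef0 expr0 mulr1 add0r cmod1 mul1r expr1.
rewrite cmodV; have s0 : 0 < cmod s by exact: lt_trans s1.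
move=> h; have : 1 <= 2 * (cmod s)^-1 by lra.
by rewrite ler_pdivlMr ?mul1r.
Qed.

Definition parameters : set R := `[-2, 1 / 4]%classic.

Lemma parameters0 : parameters 0.
Proof. by rewrite /parameters /= in_itv /=; apply/andP; split; lra. Qed.

Lemma orb_continuous k : continuous (fun c => orb c k).
Proof.
move=> c0; apply/(@cvgrPdist_lt _ _ _ (nbhs c0)) => e e0.
have [d d0 Hd] := orb_near c0 k e0.
apply/nbhs_ballP; exists d => //= c; rewrite /ball /= distrC => /Hd.
by rewrite distrC.
Qed.

(** No iterate of the critical point changes sign over the interval, by the
    intermediate value theorem. *)
Lemma kcoef_const a b : a <= b -> (forall c, a <= c <= b -> ~ zero_periodic c) ->
  kcoef a = kcoef b.
Proof.
move=> ab np; apply/funext => k; rewrite /kcoef; congr _%:C.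
apply: eq_eta => j _.
have ha : orb a j != 0 by apply/not_periodic_orb/np; rewrite lexx ab.
have hb : orb b j != 0 by apply/not_periodic_orb/np; rewrite lexx ab.
have noroot v : v \in `[a, b] -> orb v j != 0.
  by rewrite in_itv /= => /np; exact: not_periodic_orb.
have cj : {within `[a, b], continuous (fun c => orb c j)}.
  by apply: continuous_subspaceT => c; exact: orb_continuous.
have [a0|a0|/eqP] := ltrgt0P (orb a j); last by rewrite (negbTE ha).
- have [b0|b0|/eqP] := ltrgt0P (orb b j); last by rewrite (negbTE hb).
    by rewrite !gtr0_sg.
  have [|v /noroot/eqP//] := @IVT _ (fun c => orb c j) a b 0 ab cj.
  by rewrite ge_min le_max (ltW a0) (ltW b0) orbT.
- have [b0|b0|/eqP] := ltrgt0P (orb b j); last by rewrite (negbTE hb).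
    have [|v /noroot/eqP//] := @IVT _ (fun c => orb c j) a b 0 ab cj.
    by rewrite ge_min le_max (ltW a0) (ltW b0) orbT.
  by rewrite !ltr0_sg.
Qed.

(** Otherwise every parameter at which s is a zero has a neighbourhood without
    superattracting parameters, where the kneading coefficients are constant.  The
    set of these parameters is then clopen in [-2, 1/4], and contains 0, although
    K_0 has no zeros. *)
Lemma kneading_zero_near_superattracting c s : 1 < cmod s -> parameters c -> kneading_zero c s ->
  exists b, [/\ parameters b, kneading_zero b s &
    forall d, 0 < d -> exists c', superattracting c' /\ `|c' - b| < d].
Proof.
move=> s1 Ic z; apply: contrapT => nb.
pose G : set R := [set c | parameters c /\ kneading_zero c s].
have isol b : G b ->
    exists2 d, 0 < d & forall c', parameters c' -> `|c' - b| < d -> ~ zero_periodic c'.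
  case=> Ib zb; apply: contrapT => nd; apply: nb; exists b; split => // d d0.
  apply: contrapT => nc; apply: nd; exists d => // c' Ic' c'd pc'; apply: nc.
  by exists c'; split.
have : G = parameters.
  apply: (@segment_connected R (-2) (1 / 4)); first by exists c.
  - exists (interior [set c' | parameters c' -> kneading_zero c' s]); first exact: open_interior.
    apply/seteqP; split => [b Gb|b [Ib /interior_subset /(_ Ib)]] //.
    have [d d0 Hd] := isol b Gb; split; first by case: Gb.
    apply/nbhs_ballP; exists d => //= c'; rewrite /ball /= => c'd Ic'.
    have [Ib zb] := Gb.
    have np x : parameters x -> `|x - b| < d -> ~ zero_periodic x by exact: Hd.
    suff e : kcoef c' = kcoef b by rewrite /kneading_zero e.
    move: c'd; rewrite ltr_norml => /andP[h1 h2].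
    move: (Ib) (Ic'); rewrite /parameters /= !in_itv /= => /andP[i1 i2] /andP[i3 i4].
    have [bc|bc] := leP b c'.
      apply/esym/kcoef_const => // x /andP[x1 x2]; apply: Hd.
        by rewrite /parameters /= in_itv /=; apply/andP; split; lra.
      by rewrite ltr_norml; apply/andP; split; lra.
    apply/kcoef_const => [|x /andP[x1 x2]]; first exact: ltW.
    apply: Hd; first by rewrite /parameters /= in_itv /=; apply/andP; split; lra.
    by rewrite ltr_norml; apply/andP; split; lra.
  - exists (~` interior [set c' | ~ kneading_zero c' s]).
      by apply: open_closedC; exact: open_interior.
    apply/seteqP; split => [b [Ib zb]|b [Ib nib]].
      by split => // /interior_subset; apply.
    split=> //; apply: contrapT => nz; apply: nib.
    have [d d0 Hd] := kneading_nonzero_near s1 nz.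
    apply/nbhs_ballP; exists d => //= c'; rewrite /ball /= distrC => c'd.
    by apply: Hd => //; rewrite subrr cmod0.
move=> GI; have : G 0 by rewrite GI; exact: parameters0.
by case=> _; exact: kneading_zero_0.
Qed.

End Spectrum.

(** * Continuation of zeros along parameters *)
Section Continuation.
Variable R : realType.
Implicit Types (c : R) (s : R[i]).

Lemma nbhsRP (x : R) (P : set R) :
  nbhs x P <-> exists2 e : R, 0 < e & forall y, `|y - x| < e -> P y.
Proof.
split=> [/nbhs_ballP[e /= e0 He]|[e e0 He]].
  by exists e => // y ye; apply: He; rewrite /ball /= distrC.
by apply/nbhs_ballP; exists e => //= y; rewrite /ball /= distrC => /He.
Qed.

Lemma kneading_nonzero_prod (c0 : R) (s0 : R[i]) : 1 < cmod s0 -> ~ kneading_zero c0 s0 ->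
  \forall s \near s0 & c \near c0, ~ kneading_zero c s.
Proof.
move=> s01 nz; have [d d0 Hd] := kneading_nonzero_near s01 nz.
exists ([set s | cmod (s - s0) < d], [set c | `|c - c0| < d]).
  by split; [apply/nbhsCP|apply/nbhsRP]; exists d.
by move=> [s c] [/= sd cd]; exact: Hd.
Qed.

Lemma compact_zero_free (K : set R[i]) c0 : compact K -> (forall s, K s -> 1 < cmod s) ->
  (forall s, K s -> ~ kneading_zero c0 s) ->
  \forall c \near c0, forall s, K s -> ~ kneading_zero c s.
Proof.
move=> /compact_near_coveringP cK K1 nz.
by apply: (cK R (nbhs c0) (fun c s => ~ kneading_zero c s)) => s Ks;
  apply: kneading_nonzero_prod; [exact: K1|exact: nz].
Qed.

(** The projection of a closed set along the compact set J is closed. *)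
Lemma zero_slice_compact (J : set R) (K : set R[i]) : compact J -> compact K ->
  (forall s, K s -> 1 < cmod s) ->
  compact [set s | K s /\ exists2 c, J c & kneading_zero c s].
Proof.
move=> /compact_near_coveringP cJ cK K1.
have cclK : closed K := compact_closed (@norm_hausdorff R[i] R[i]^o) cK.
apply: (subclosed_compact _ cK); last by move=> s [].
move=> s cls; have Ks : K s by apply: cclK; apply: closureS cls => x [].
split=> //; apply: contrapT => nz.
have H : \forall s' \near s, forall c, J c -> ~ kneading_zero c s'.
  apply: (cJ R[i] (nbhs s) (fun s' c => ~ kneading_zero c s')) => c Jc.
  have : ~ kneading_zero c s by move=> z; apply: nz; exists c.
  move=> /(kneading_nonzero_prod (K1 s Ks)) [[A B] /= [sA cB] AB].
  by exists (B, A) => // -[c' s'] [/= Bc As]; exact: (AB (s', c')).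
by have [s' [[_ [c Jc z]] /(_ c Jc)]] := cls _ H.
Qed.

Lemma clopen_complement (T : topologicalType) (A D : set T) : D <> A ->
  (exists2 V, open V & D = A `&` V) -> (exists2 C, closed C & D = A `&` C) ->
  [/\ A `\` D !=set0, exists2 V, open V & A `\` D = A `&` V
    & exists2 C, closed C & A `\` D = A `&` C].
Proof.
move=> DneA [V oV DV] [C cC DC]; split.
- apply: contrapT => /set0P/negP; rewrite negbK => /eqP AD; apply: DneA.
  apply/seteqP; split; first by rewrite DV => x [].
  by move=> x Ax; apply: contrapT => nDx; have : (A `\` D) x by []; rewrite AD.
- exists (~` C); first exact: closed_openC.
  by rewrite DC setDE setCI setIUr setICr set0U.
- exists (~` V); first exact: open_closedC.
  by rewrite DV setDE setCI setIUr setICr set0U.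
Qed.

(** The set of parameters with a zero in K is closed in J since K is compact, and
    open in J since zeros persist and zeros close to K over J lie in K. *)
Lemma continuation (J : set R) (K : set R[i]) : connected J -> compact K ->
  (forall s, K s -> 1 < cmod s) ->
  (forall c s, J c -> K s -> kneading_zero c s -> exists2 r, 0 < r &
     forall c' s', J c' -> cmod (s' - s) < r -> 1 < cmod s' -> kneading_zero c' s' -> K s') ->
  (exists c s, [/\ J c, K s & kneading_zero c s]) ->
  forall c, J c -> exists2 s, K s & kneading_zero c s.
Proof.
move=> cJ cK K1 op [c0 [s0 [Jc0 Ks0 z0]]].
pose B : set R := [set c | exists2 s, K s & kneading_zero c s].
suff : J `&` B = J by move=> JB c; rewrite -[X in X c]JB => -[].
apply: cJ.
- by exists c0; split => //; exists s0.
- exists (interior [set c | J c -> B c]); first exact: open_interior.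
  apply/seteqP; split => [c [Jc [s Ks z]]|c [Jc /interior_subset /(_ Jc)]] //.
  split=> //; have [r r0 Hr] := op c s Jc Ks z.
  have [d d0 Hd] := kneading_zero_persists (K1 s Ks) z r0.
  apply/nbhsRP; exists d => // c' /Hd[s' [s'r s'1 z']] Jc'.
  by exists s' => //; exact: Hr z'.
- exists (~` interior [set c | ~ B c]).
    by apply: open_closedC; exact: open_interior.
  apply/seteqP; split => [c [Jc Bc]|c [Jc nB]].
    by split => // /interior_subset; apply.
  split=> //; apply: contrapT => nBc; apply: nB.
  have : \forall c' \near c, forall s, K s -> ~ kneading_zero c' s.
    by apply: compact_zero_free => // s Ks z; apply: nBc; exists s.
  by apply: filterS => c' H [s Ks z]; exact: H z.
Qed.

Lemma superattracting_zero c s : 1 < cmod s -> zero_periodic c ->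
  (exists F, is_kneading_ratfun c F /\ ratfun_root F s^-1) <-> kneading_zero c s.
Proof.
move=> s1 /zero_periodic_period[p zp]; have t1 := cmodV_lt1 s1.
have p0 : (0 < p)%N by case: zp.
apply: (iff_trans (kneading_root zp (expr_neq1 p0 t1))).
exact: iff_sym (vanish_period zp t1).
Qed.

Definition outer_zeros : set R[i] :=
  [set s | 1 < cmod s /\ exists2 c, parameters c & kneading_zero c s].

(** From left to right by compactness of the parameter interval, from right to left
    by [kneading_zero_near_superattracting] and persistence of zeros. *)
Lemma spectrum_outside s : 1 < cmod s -> kneading_spectrum s <-> outer_zeros s.
Proof.
move=> s1; split=> [cl|[_ [c Ic z]]].
  split=> //; apply: contrapT => nz.
  have /compact_near_coveringP cI := @segment_compact R (-2) (1 / 4).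
  have H : \forall s' \near s, forall c, parameters c -> ~ kneading_zero c s'.
    apply: (cI R[i] (nbhs s) (fun s' c => ~ kneading_zero c s')) => c Ic.
    have : ~ kneading_zero c s by move=> z; apply: nz; exists c.
    move=> /(kneading_nonzero_prod s1) [[A B] /= [sA cB] AB].
    by exists (B, A) => // -[c' s'] [/= Bc As]; exact: (AB (s', c')).
  have H1 : \forall s' \near s, 1 < cmod s'.
    apply/nbhsCP; exists (cmod s - 1); first by rewrite subr_gt0.
    by move=> w; exact: cmod_gt1_near.
  have [s' [[s'0 [c [[Ic pc] hF]]] [/(_ c Ic) nz' s'1]]] := cl _ (filterI H H1).
  by apply: nz'; apply/(superattracting_zero s'1 pc).
have [b [Ib zb Hb]] := kneading_zero_near_superattracting s1 Ic z.
move=> U /nbhsCP[e e0 He].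
have [d d0 Hd] := kneading_zero_persists s1 zb e0.
have [c' [sc' c'd]] := Hb d d0.
have [s' [s'e s'1 z']] := Hd c' c'd.
exists s'; split; last exact: He.
split; first by rewrite -cmod_gt0 (lt_trans ltr01).
by exists c'; split => //; apply/superattracting_zero => //; case: sc'.
Qed.

(** The outer zeros are connected im kleinen.  For each c with s0 as a zero, the
    zeros in a small disc around s0 and over a short interval J around c form a
    connected set W, as every nonempty clopen part of W continues to c, where s0 is
    the only zero in the disc. *)
Lemma outer_zeros_cik s0 (U : set R[i]) : open U -> U s0 -> outer_zeros s0 ->
  \forall s \near s0, outer_zeros s -> connected_component (outer_zeros `&` U) s0 s.
Proof.
move=> oU Us0 [s01 ex0].
have /compact_near_coveringP cI := @segment_compact R (-2) (1 / 4).
have key c : parameters c -> \forall c' \near c & s \near s0, 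
    parameters c' -> kneading_zero c' s -> connected_component (outer_zeros `&` U) s0 s.
  move=> Ic; have [z|nz] := pselect (kneading_zero c s0); last first.
    have [[A B] /= [sA cB] AB] := kneading_nonzero_prod s01 nz.
    exists (B, A) => // -[c' s'] [/= Bc As] _ z'; exfalso.
    exact: (AB (s', c')) z'.
  have [r1 r10 Hr1] := kneading_zero_isolated c s01.
  have /nbhsCP[r2 r20 Hr2] : nbhs s0 U by exact: open_nbhs_nbhs.
  pose r := Num.min r1 (r2 / 2).
  have r0 : 0 < r by rewrite lt_min r10 divr_gt0.
  have rr1 : r <= r1 by rewrite ge_min lexx.
  have rr2 : r < r2 by rewrite gt_min; apply/orP; right; lra.
  have K1 s : cball s0 r s -> 1 < cmod s.
    by rewrite /cball /= => sr; have [|] := Hr1 s; first exact: le_trans rr1.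
  have S1 s : csphere s0 r s -> 1 < cmod s.
    by rewrite /csphere /= => sr; apply: K1; rewrite /cball /= sr.
  have /nbhsRP[d d0 Hd] : \forall c' \near c, forall s, csphere s0 r s -> ~ kneading_zero c' s.
    apply: compact_zero_free => //; first exact: csphere_compact.
    move=> s sr z'; have [|_ /(_ z') e] := Hr1 s; first by rewrite sr.
    by move: sr; rewrite /csphere /= e subrr cmod0 => rz; rewrite -rz ltxx in r0.
  pose a := Num.max (-2) (c - d / 2).
  pose b := Num.min (1 / 4) (c + d / 2).
  pose J : set R := `[a, b]%classic.
  have d2 : 0 < d / 2 by rewrite divr_gt0.
  have Jc' c' : parameters c' -> `|c' - c| <= d / 2 -> J c'.
    rewrite /parameters /J /= !in_itv /= /a /b ge_max le_min => /andP[-> ->].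
    by rewrite ler_distl => /andP[-> ->].
  have JI c' : J c' -> parameters c'.
    by rewrite /parameters /J /= !in_itv /= /a /b ge_max le_min => /andP[/andP[-> _] /andP[-> _]].
  have Jd c' : J c' -> `|c' - c| < d.
    rewrite /J /= in_itv /= /a /b ge_max le_min => /andP[/andP[_ h1] /andP[_ h2]].
    by rewrite ltr_distl; apply/andP; split; lra.
  have Jc : J c by apply: Jc' => //; rewrite subrr normr0 ltW.
  pose W : set R[i] := [set s | cball s0 r s /\ exists2 c', J c' & kneading_zero c' s].
  have cW : compact W.
    apply: zero_slice_compact => //; [exact: segment_compact|exact: cball_compact].
  have Ws0 : W s0 by split; [rewrite /cball /= subrr cmod0 ltW|exists c].
  have WE : W `<=` outer_zeros `&` U.
    move=> s [sr [c' Jc1 z']]; split; last by apply: Hr2; exact: le_lt_trans rr2.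
    by split; [exact: K1|exists c' => //; exact: JI].
  (* [continuation] takes a zero in D to one over c, which can only be s0 *)
  have center D : D !=set0 -> (exists2 O, open O & D = W `&` O) ->
      (exists2 C, closed C & D = W `&` C) -> D s0.
    move=> [s Ds] [V oV DV] [C cC DC].
    have cD : compact D by rewrite DC; exact: compact_closedI.
    have DW x : D x -> W x by rewrite DV => -[].
    have [|||x Dx zx] := continuation (@segment_connected R a b) cD _ _ _ Jc.
    - by move=> x /DW[/K1].
    - move=> c1 x Jc1 Dx zx; have [xr _] := DW x Dx.
      have xr' : cmod (x - s0) < r.
        rewrite lt_neqAle xr andbT; apply/eqP => xs.
        exact: (Hd c1 (Jd _ Jc1) x xs) zx.
      have /nbhsCP[e e0 He] : nbhs x V.
        by apply: open_nbhs_nbhs; split => //; move: Dx; rewrite DV => -[].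
      exists (Num.min e (r - cmod (x - s0))); first by rewrite lt_min e0 subr_gt0.
      move=> c2 y Jc2; rewrite lt_min => /andP[ye yr] y1 zy; rewrite DV.
      split; last exact: He.
      split; last by exists c2.
      by rewrite /cball /=; have := cmod_tri y x s0; lra.
    - have [_ [c1 Jc1 z1]] := DW s Ds.
      by exists c1, s.
    - have [xr _] := DW x Dx.
      by have [|_ /(_ zx) <-] := Hr1 x; first exact: le_trans rr1.
  have conW : connected W.
    move=> D D0 oD cD; apply: contrapT => /clopen_complement/(_ oD cD)[D'0 oD' cD'].
    by have [_ []] := center _ D'0 oD' cD'; exact: center.
  exists ([set c' | `|c' - c| < d / 2], [set s | cmod (s - s0) < r]).
    by split; [apply/nbhsRP; exists (d / 2)|apply/nbhsCP; exists r].
  move=> [c' s] [/= c'd sr] Ic' z'.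
  apply: (connected_component_max Ws0 WE conW).
  by split; [exact: ltW|exists c' => //; apply: Jc' => //; exact: ltW].
have := cI R[i] (nbhs s0) (fun s c => parameters c -> kneading_zero c s ->
  connected_component (outer_zeros `&` U) s0 s) (nbhs_filter s0) key.
move=> /nbhsCP[e e0 He]; apply/nbhsCP; exists e => // s se [_ [c Ic z']].
exact: (He s se c Ic Ic z').
Qed.

End Continuation.

(** * Parameters near the tip and roots near the unit circle *)
Section Circle.
Variable R : realType.
Implicit Types (c : R) (s t w : R[i]).

Lemma orb_tip k : orb (-2 : R) k.+1 = 2.
Proof.
elim: k => [|k IH]; first by rewrite /= /quad; lra.
by rewrite iterS IH /quad; lra.
Qed.

(** Induction on m, c being the smallest zero of x |-> f_x^m(x) in [-2, -1].  At such
    a c the next iterate is c < 0, whereas it is 2 at the parameter -2; so its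
    smallest zero lies strictly between. *)
Lemma tip_parameter m : (0 < m)%N -> exists c, [/\ -2 <= c <= -1, orb c m = 0,
    forall j, (0 < j < m)%N -> 0 < orb c j &
    forall x j, -2 <= x < c -> (0 < j <= m)%N -> 0 < orb x j].
Proof.
case: m => // m _; elim: m => [|m [c [/andP[c2 c1] oc pc px]]].
  exists (-1); split.
  - by apply/andP; split; lra.
  - by rewrite /= /quad; lra.
  - by case=> [|[|j]].
  - move=> x [|[|j]] //= /andP[x2 x1] _; rewrite /quad; nra.
(* its infimum is the smallest zero of the iterate *)
pose S : set R := [set x | -2 <= x <= c /\ orb x m.+2 <= 0].
have Sc : S c by split; [apply/andP; split|rewrite iterS oc /quad; lra].
have lbS : has_inf S by split; [exists c|exists (-2) => x [/andP[]]].
pose c' := inf S.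
have c'2 : -2 <= c' by apply: lb_le_inf; [exists c|move=> x [/andP[]]].
have c'c : c' <= c by apply: ge_inf => //; case: lbS.
have cont := @orb_continuous R m.+2.
have pos x : -2 <= x < c' -> 0 < orb x m.+2.
  move=> /andP[x2 xc']; rewrite ltNge; apply/negP => xn.
  have : c' <= x.
    apply: ge_inf; first by case: lbS.
    by split=> //; rewrite x2 /=; lra.
  lra.
have npos : orb c' m.+2 <= 0.
  rewrite leNgt; apply/negP => g0.
  have /nbhsRP[e e0 He] : \forall x \near c', 0 < orb x m.+2.
    exact: (cvgr_gt _ (cont c')).
  have [x Sx xe] := inf_adherent e0 lbS.
  have c'x : c' <= x by apply: ge_inf => //; case: lbS.
  have : 0 < orb x m.+2 by apply: He; rewrite ger0_norm -/c' in xe *; lra.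
  by case: Sx => _; rewrite leNgt => /negbTE ->.
have oc' : orb c' m.+2 = 0.
  have [||v] := @IVT _ (fun x => orb x m.+2) (-2) c' 0 c'2.
  - by apply: continuous_subspaceT => x; exact: cont.
  - by rewrite orb_tip ge_min npos orbT le_max ler0n.
  rewrite in_itv /= => /andP[v2 vc'] ov.
  have : c' <= v.
    apply: ge_inf; first by case: lbS.
    by split; [rewrite v2 (le_trans vc')|rewrite /= ov].
  by move=> c'v; have <- : v = c' by lra.
have c'lt : c' < c.
  rewrite lt_neqAle c'c andbT; apply/eqP => e.
  by move: oc'; rewrite e iterS oc /quad; lra.
exists c'; split=> //.
- by apply/andP; split; lra.
- by move=> j jm; apply: px => //; rewrite c'2.
- move=> x j xc' /andP[j0]; rewrite leq_eqVlt => /predU1P[->|jm]; first exact: pos.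
  apply: px; last by rewrite j0.
  by move: xc' => /andP[-> /lt_trans ->].
Qed.

(** The critical orbit is negative once and then positive until it returns to 0, so
    P(t) = 1 - t - t^2 - ... - t^(n-1). *)
Lemma tip_polynomial n : (1 < n)%N -> exists c, [/\ superattracting c, zero_period c n &
  forall t, (1 - t) * (psum (kcoef c) n).[t] = 1 - 2 * t + t ^+ n].
Proof.
case: n => [|[|m]] // _.
have [c [/andP[c2 c1] oc pc _]] := @tip_parameter m.+1 isT.
have o k : iter k.+1 (quad c) 0 = orb c k by rewrite iterSr /quad expr0n add0r.
have zp : zero_period c m.+2.
  split=> //; first by rewrite o.
  move=> [|q] // /andP[_ qm]; rewrite o; apply/eqP.
  case: q qm => [|q] qm; first by rewrite /= lt_eqF //; lra.
  by rewrite gt_eqF // pc.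
exists c; split => //.
  split; last by exists m.+2; case: zp.
  by rewrite in_itv /=; apply/andP; split; lra.
have e1 k : (0 < k <= m.+1)%N -> eta c k c = -1.
  elim: k => [|[|k] IH] // km; rewrite etaS.
    by rewrite eta0 mul1r ltr0_sg //=; lra.
  by rewrite IH ?gtr0_sg ?mulr1 ?pc //=; lia.
move=> t; suff H N : (N <= m.+1)%N ->
  (1 - t) * (psum (kcoef c) N.+1).[t] = 1 - 2 * t + t ^+ N.+1 by exact: H.
elim: N => [_|N IH NM]; first by rewrite psumS psum0 kcoef0; ring.
by rewrite psumS mulrDr IH 1?ltnW // /kcoef e1 // rmorphN1 !exprS; ring.
Qed.

(** Up to the factor -p^2, the expression p'^2 - p'' p is the derivative of p'/p;
    that is, (p'^2 - p'' p)(w) = p(w)^2 sum 1 / (w - r)^2. *)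
Lemma log_deriv2_bound (rs : seq R[i]) w (d : R) : 0 < d ->
  (forall r, r \in rs -> d <= cmod (w - r)) ->
  let p := \prod_(r <- rs) ('X - r%:P) in
  cmod (p^`().[w] ^+ 2 - p^`()^`().[w] * p.[w]) * d ^+ 2 <= cmod p.[w] ^+ 2 * (size rs)%:R.
Proof.
move=> d0; elim: rs => [|r rs IH] H /=.
  by rewrite big_nil -polyC1 derivC deriv0 !horner0 expr0n mul0r subr0 cmod0 mul0r mulr0.
rewrite big_cons; set p := \prod_(_ <- _) _ in IH *.
have IH' : cmod (p^`().[w] ^+ 2 - p^`()^`().[w] * p.[w]) * d ^+ 2 <= cmod p.[w] ^+ 2 * (size rs)%:R.
  by apply: IH => x xrs; apply: H; rewrite inE xrs orbT.
have dr : d <= cmod (w - r) by apply: H; rewrite mem_head.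
rewrite derivM derivXsubC mul1r derivD derivM derivXsubC mul1r.
rewrite !(hornerD, hornerM, hornerN, hornerX, hornerC).
set a := p.[w] in IH' *; set a1 := p^`().[w] in IH' *; set a2 := p^`()^`().[w] in IH' *.
have -> : (a + (w - r) * a1) ^+ 2 - (a1 + (a1 + (w - r) * a2)) * ((w - r) * a)
  = a ^+ 2 + (w - r) ^+ 2 * (a1 ^+ 2 - a2 * a) by ring.
have d2 : d ^+ 2 <= cmod (w - r) ^+ 2 by rewrite lerXn2r ?nnegrE ?cmod_ge0 // ltW.
have d20 : 0 <= d ^+ 2 by rewrite exprn_ge0 // ltW.
have D0 : 0 <= cmod (w - r) ^+ 2 by rewrite exprn_ge0 ?cmod_ge0.
have A0 : 0 <= cmod a ^+ 2 by rewrite exprn_ge0 ?cmod_ge0.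
apply: (le_trans (ler_wpM2r d20 (cmodD _ _))).
rewrite (cmodM (_ ^+ 2)) !cmodX (cmodM (w - r)) exprMn -natr1.
have := ler_wpM2l D0 IH'; have := ler_wpM2l A0 d2; lra.
Qed.

(** Let q = X^n - 2 X + 1.  For |w| = 1 we have |q(w)| <= 4, while q'^2 - q'' q has
    modulus at least n^2 - 6n - 4 at w.  By [log_deriv2_bound] some root of q is at
    distance O(n^(-1/2)) from w. *)
Lemma root_near_circle w (d : R) : cmod w = 1 -> 0 < d ->
  exists N, forall n, (N <= n)%N -> exists2 t, cmod (w - t) < d & 1 - 2 * t + t ^+ n = 0.
Proof.
move=> w1 d0.
have [N0 HN0] : exists N0 : nat, 64 / d ^+ 2 < N0%:R.
  by exists (Num.bound (64 / d ^+ 2)); rewrite archi_boundP // divr_ge0 // exprn_ge0 // ltW.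
exists (maxn N0 10) => n; rewrite geq_max => /andP[Nn n10].
pose q : {poly R[i]} := 'X^n - (2 *: 'X - 1).
have qE t : q.[t] = 1 - 2 * t + t ^+ n by rewrite !hornerE; ring.
have sz1 : (size (2 *: 'X - 1 : {poly R[i]})%R < size ('X^n : {poly R[i]})%R)%N.
  rewrite size_polyXn ltnS (leq_trans (size_polyD _ _)) // geq_max size_polyN size_poly1.
  rewrite (leq_trans (size_scale_leq _ _)) ?size_polyX; lia.
have mq : lead_coef q = 1 by rewrite lead_coefDl ?size_polyN // lead_coefXn.
have sq : size q = n.+1 by rewrite size_polyDl ?size_polyN // size_polyXn.
have [rs qrs] := closed_field_poly_normal q.
rewrite mq scale1r in qrs.
have srs : size rs = n by move: sq; rewrite qrs size_prod_XsubC => -[].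
apply: contrapT => nroot.
have far r : r \in rs -> d <= cmod (w - r).
  move=> rrs; rewrite leNgt; apply/negP => rd; apply: nroot; exists r => //.
  by rewrite -qE; apply/rootP; rewrite qrs root_prod_XsubC.
have := log_deriv2_bound d0 far; rewrite -qrs srs /=.
have dq : q^`() = 'X^(n.-1) *+ n - 2%:P.
  by rewrite /q derivB derivXn derivB derivZ derivX derivC subr0 alg_polyC.
have q1 : q^`().[w] = n%:R * w ^+ n.-1 - 2.
  by rewrite dq hornerD hornerN hornerMn hornerXn hornerC mulr_natl.
have q2 : q^`()^`().[w] = n%:R * (n.-1)%:R * w ^+ n.-2.
  rewrite dq derivB derivC subr0 derivMn derivXn !hornerMn hornerXn.
  by rewrite -mulrA !mulr_natl.
rewrite q1 q2 qE.
have n2 : n = n.-2.+2 by lia.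
have n1 : n.-1 = n.-2.+1 by lia.
have nR : (n.-1%:R : R[i]) = n%:R - 1 by rewrite n1 {2}n2 -[X in _ = X%:R - _]addn1 natrD addrK.
set z := w ^+ n.-2.
have z1 : cmod z = 1 by rewrite cmodX w1 expr1n.
have -> : w ^+ n = w * (w * z) by rewrite {1}n2 !exprS.
have -> : w ^+ n.-1 = w * z by rewrite n1 exprS.
clearbody z.
have zw1 : cmod (w * z) = 1 by rewrite cmodM w1 z1 mulr1.
have zww1 : cmod (w * (w * z)) = 1 by rewrite cmodM w1 zw1 mulr1.
have cn : cmod (n%:R : R[i]) = n%:R by exact: cmod_nat.
have w2 : 1 <= cmod (2 * w - 1).
  by have := cmodB_ge (2 * w) 1; rewrite cmodM cmod1 cmod_nat w1; lra.
have qw : cmod (1 - 2 * w + w * (w * z)) <= 4.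
  have := cmodD (1 - 2 * w) (w * (w * z)); have := cmodB_le 1 (2 * w).
  by rewrite cmodM cmod1 cmod_nat w1 zww1; lra.
rewrite nR.
have -> : (n%:R * (w * z) - 2) ^+ 2 - n%:R * (n%:R - 1) * z * (1 - 2 * w + w * (w * z)) =
  n%:R * (n%:R - 1) * z * (2 * w - 1)
    - ((- n%:R) * (w * z) ^+ 2 + (4 * n%:R * (w * z) - 4)) :> R[i].
  by ring.
set A := _ * z * (2 * w - 1); set B := _ + (_ - 4).
have hY : cmod B <= 5 * n%:R + 4.
  have := cmodD ((- n%:R) * (w * z) ^+ 2) (4 * n%:R * (w * z) - 4).
  have := cmodB_le (4 * n%:R * (w * z)) 4.
  rewrite !cmodM cmodN !cmod_nat w1 z1; lra.
have hX : n%:R * (n%:R - 1) <= cmod A.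
  have nRR : (n%:R - 1 : R) = n.-1%:R by rewrite n1 {1}n2 -addn1 natrD addrK.
  by rewrite /A -nR !cmodM z1 !cmod_nat mulr1 nRR ler_peMr // mulr_ge0.
have hZ := cmodB_ge A B; set Z := cmod (A - B) in hZ *.
set Q := cmod _ in qw *; have Q0 : 0 <= Q by exact: cmod_ge0.
have d2 : 0 < d ^+ 2 by rewrite exprn_gt0.
move: HN0; rewrite ltr_pdivrMr // => HN0 H.
have NR : N0%:R <= n%:R :> R by rewrite ler_nat.
have n10R : 10 <= n%:R :> R by rewrite (ler_nat _ 10).
have Q2 : Q ^+ 2 <= 16 by nra.
have h1 : n%:R ^+ 2 / 4 <= Z by nra.
have h2 : Z * d ^+ 2 <= 16 * n%:R by rewrite (le_trans H) // ler_wpM2r.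
have h3 : 64 < n%:R * d ^+ 2 by rewrite (lt_le_trans HN0) // ler_wpM2r // ltW.
have h4 : n%:R ^+ 2 / 4 * d ^+ 2 <= 16 * n%:R by rewrite (le_trans _ h2) // ler_wpM2r // ltW.
have : 64 * n%:R < n%:R * d ^+ 2 * n%:R :> R by rewrite ltr_pM2r // (lt_le_trans _ n10R).
lra.
Qed.

End Circle.

(** * The unit circle *)
Section CircleSpectrum.
Variable R : realType.
Implicit Types (c : R) (s t w u : R[i]).

Lemma circle_dist s w : cmod w = 1 -> s != 0 -> cmod (s^-1 - w^-1) = cmod (w - s) / cmod s.
Proof.
move=> w1 s0; have w0 : w != 0 by rewrite -cmod_gt0 w1.
have -> : s^-1 - w^-1 = (w - s) / s / w by field; rewrite s0 w0.
by rewrite !cmodM !cmodV w1 invr1 mulr1.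
Qed.

(** The point 1 is a root of 1 - 2t + t^n that comes from the factor 1 - t, not from
    P.  No other root of it is an n-th root of unity, so the denominator 1 - t^n of
    K_c does no harm. *)
Lemma circle_sub_spectrum_neq1 u : cmod u = 1 -> u != 1 -> kneading_spectrum u.
Proof.
move=> u1 un1; have u0 : u != 0 by rewrite -cmod_gt0 u1.
pose w := u^-1; have w1 : cmod w = 1 by rewrite cmodV u1 invr1.
have wn1 : w != 1 by rewrite invr_eq1.
move=> U /nbhsCP[e e0 He].
have wd : 0 < cmod (w - 1) by rewrite cmod_gt0 subr_eq0.
pose d := Num.min (Num.min (e / 2) (1 / 2)) (cmod (w - 1)).
have d0 : 0 < d by rewrite !lt_min wd !divr_gt0.
have [N HN] := root_near_circle w1 d0.
pose n := maxn N 2.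
have n1 : (1 < n)%N by rewrite leq_maxr.
have [t + qt] := HN n (leq_maxl _ _).
rewrite !lt_min => /andP[/andP[te t2] tw].
have [c [sc zp Hc]] := tip_polynomial R n1.
have tn1 : t != 1 by apply: contraTneq tw => ->; rewrite ltxx.
have t0 : 1 / 2 < cmod t by have := cmodB_ge w t; rewrite w1; lra.
have tn0 : t != 0 by rewrite -cmod_gt0; lra.
have tn : t ^+ n != 1.
  apply: contra tn1 => /eqP tn; move: qt; rewrite tn => h.
  have : 2 * (1 - t) = 0 by rewrite -h; ring.
  by move/eqP; rewrite mulf_eq0 pnatr_eq0 /= subr_eq0 eq_sym.
exists t^-1; split.
  split; first by rewrite invr_eq0.
  exists c; split => //; rewrite invrK; apply/(kneading_root zp tn)/rootP/eqP.
  have /eqP := Hc t; rewrite qt mulf_eq0 subr_eq0 eq_sym (negbTE tn1) //=.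
apply: He; rewrite -[u]invrK circle_dist // ltr_pdivrMr; last by lra.
by rewrite -/w; nra.
Qed.

Lemma circle_sub_spectrum u : cmod u = 1 -> kneading_spectrum u.
Proof.
move=> u1; have [->|un1] := eqVneq u 1; last exact: circle_sub_spectrum_neq1.
have cl : closed (@kneading_spectrum R) by exact: closed_closure.
apply: cl => U /nbhsCP[e e0 He].
(* Cayley points (1+ih)/(1-ih) tend to 1 along the circle *)
pose h : R := e / 4; have h0 : 0 < h by rewrite divr_gt0.
pose v : R[i] := 1 - 'i * h%:C.
pose vc : R[i] := 1 + 'i * h%:C.
have vv : v^* = vc by rewrite /v /vc; simpc.
have v1 : 1 <= cmod v.
  have := cmodD v v^*; rewrite cmod_conj vv.
  have -> : v + vc = 2 by rewrite /v /vc; ring.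
  by rewrite cmod_nat; lra.
have vn0 : v != 0 by rewrite -cmod_gt0; lra.
have ww1 : vc / v - 1 = 2 * 'i * h%:C / v.
  have -> : 2 * 'i * h%:C = vc - v by rewrite /v /vc; ring.
  by rewrite mulrBl mulfV.
have ci : cmod ('i : R[i]) = 1 by rewrite /cmod /= expr0n expr1n add0r sqrtr1.
have cw : cmod (vc / v) = 1 by rewrite cmodM cmodV -vv cmod_conj mulfV // cmod_eq0.
have hn0 : h%:C != 0 :> R[i] by rewrite -cmod_gt0 cmodR gtr0_norm.
have i0 : 'i != 0 :> R[i] by rewrite -cmod_gt0 ci.
have wn1 : vc / v != 1.
  by rewrite -subr_eq0 ww1 !mulf_neq0 ?invr_eq0 // pnatr_eq0.
exists (vc / v); split; first exact: circle_sub_spectrum_neq1.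
apply: He; rewrite ww1 !cmodM cmodV cmod_nat ci mulr1 cmodR gtr0_norm // ltr_pdivrMr; last by lra.
by rewrite /h; nra.
Qed.

Lemma circle_connected : connected [set u : R[i] | cmod u = 1].
Proof.
pose f (e x : R) : R[i] := x +i* (e * Num.sqrt (1 - x ^+ 2)).
have fc e : continuous (f e).
  move=> x; have cs : {for x, continuous (fun x : R => e * Num.sqrt (1 - x ^+ 2))}.
    apply: (@cvgM _ _ (nbhs x)); first exact: (@cvg_cst R^o).
    apply: (@continuous_comp _ _ _ (fun x : R => 1 - x ^+ 2) (@Num.sqrt R));
      last exact: sqrt_continuous.
    apply: (@cvgB _ R^o _ (nbhs x)); first exact: (@cvg_cst R^o).
    exact: exprn_continuous.
  have cg : {for x, continuous (fun x : R => (x, e * Num.sqrt (1 - x ^+ 2)))}.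
    exact: (@cvg_pair _ _ _ (nbhs x) (nbhs x) (nbhs (e * Num.sqrt (1 - x ^+ 2)))
      _ _ _ id _ (@cvg_id _ (nbhs x)) cs).
  exact: (@continuous_comp R (R * R)%type R[i] _ _ x cg (@complex_continuous R _)).
have fcon e : connected (f e @` `[-1, 1]).
  apply: connected_continuous_connected; first exact: segment_connected.
  by apply: continuous_subspaceT => x; exact: fc.
have -> : [set u : R[i] | cmod u = 1] = f 1 @` `[-1, 1] `|` f (-1) @` `[-1, 1].
  have mod1 (x y : R) : cmod (x +i* y) = 1 <-> x ^+ 2 + y ^+ 2 = 1.
    split=> h; last by rewrite /cmod /= h sqrtr1.
    rewrite -[RHS](expr1n _ 2) -h /cmod /= sqr_sqrtr //.
    by rewrite addr_ge0 // sqr_ge0.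
  have on_circle e x : e ^+ 2 = 1 -> x \in `[-1, 1] -> cmod (f e x) = 1.
    rewrite in_itv /= => e1 /andP[x0 x1]; apply/mod1.
    rewrite exprMn e1 mul1r sqr_sqrtr; first by ring.
    nra.
  apply/seteqP; split => [[x y] /mod1 xy1|u [[x x1 <-]|[x x1 <-]]]; last 2 first.
  - by apply: on_circle => //; rewrite expr1n.
  - by apply: on_circle => //; rewrite sqrrN expr1n.
  have x1 : x \in `[-1, 1].
    by rewrite in_itv /= -ler_norml -(@ler_pXn2r _ 2) ?nnegrE //
      real_normK ?num_real // expr1n; have := sqr_ge0 y; lra.
  have yE : Num.sqrt (1 - x ^+ 2) = `|y|.
    have -> : 1 - x ^+ 2 = y ^+ 2 by lra.
    exact: sqrtr_sqr.
  have [y0|y0] := leP 0 y.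
    by left; exists x => //; rewrite /f yE ger0_norm // mul1r.
  by right; exists x => //; rewrite /f yE ltr0_norm // mulN1r opprK.
apply: connectedU; [|exact: fcon|exact: fcon].
have f1 e : (f e @` `[-1, 1]) 1.
  exists 1; last by rewrite /f expr1n subrr sqrtr0 mulr0.
  by rewrite /= in_itv /=; apply/andP; split; lra.
by exists 1.
Qed.

End CircleSpectrum.

(** * Topology of the spectrum *)
Section Conclusion.
Variable R : realType.

Let X := @kneading_spectrum R `&` [set z : R[i] | 1 <= cmod z].

Lemma X_closed : closed X.
Proof.
apply: closedI; first exact: closed_closure.
exact: (closed_comp (fun x _ => @cmod_continuous R x) (@closed_ge R 1)).
Qed.

(** Otherwise D is compact and lies in |z| > 1, so that its zeros continue to the
    parameter 0, for which there are none. *)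
Lemma clopen_meets_circle (D : set R[i]) : D !=set0 ->
  (exists2 V, open V & D = X `&` V) -> (exists2 C, closed C & D = X `&` C) ->
  exists2 z, D z & cmod z = 1.
Proof.
move=> [s Ds] [V oV DV] [C cC DC]; apply: contrapT => nD.
have DX z : D z -> X z by rewrite DV => -[].
have D1 z : D z -> 1 < cmod z.
  move=> Dz; have [_ /= z1] := DX z Dz; rewrite lt_neqAle z1 andbT.
  by apply/eqP => z1'; apply: nD; exists z.
have Dz z : D z -> exists2 c, parameters c & kneading_zero c z.
  by move=> Dz; have [/(spectrum_outside (D1 z Dz))[]] := DX z Dz.
have cD : compact D.
  apply: (@bounded_closed_compact _ _ 2).
    by rewrite DC; apply: closedI => //; exact: X_closed.
  by move=> z zD; have [c _ zc] := Dz z zD; exact: kneading_zero_bounded (D1 z zD) zc.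
have [||z zD] :=
  continuation (J := @parameters R) (@segment_connected R _ _) cD D1 _ _ (parameters0 R).
- move=> c z Ic zD _; have /nbhsCP[e e0 He] : nbhs z V.
    by apply: open_nbhs_nbhs; split => //; move: zD; rewrite DV => -[].
  exists e => // c' z' Ic' z'e z'1 z'c; rewrite DV; split; last exact: He.
  split; last exact: ltW.
  by apply/(spectrum_outside z'1); split=> //; exists c'.
- by have [c Ic zc] := Dz s Ds; exists c, s.
- exact: kneading_zero_0 (D1 z zD).
Qed.

Lemma spectrum_connected : connected X.
Proof.
move=> D D0 [V oV DV] [C cC DC]; apply: contrapT => DneX.
have [z Dz z1] : exists2 z, D z & cmod z = 1.
  by apply: clopen_meets_circle => //; [exists V|exists C].
have [w [Xw nDw] w1] : exists2 w, (X `\` D) w & cmod w = 1.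
  have [||*] := clopen_complement DneX; [by exists V|by exists C|exact: clopen_meets_circle].
have circX : [set u : R[i] | cmod u = 1] `<=` X.
  by move=> u /= u1; split; [exact: circle_sub_spectrum|rewrite /= u1].
suff : [set u : R[i] | cmod u = 1] `&` D = [set u : R[i] | cmod u = 1].
  by move=> /seteqP[_ /(_ w w1)[]].
apply: circle_connected.
- by exists z.
- exists V => //; rewrite DV; apply/seteqP; split => x; first by move=> [? [_ ?]].
  by move=> [x1 Vx]; split=> //; split=> //; exact: circX.
- exists C => //; rewrite DC; apply/seteqP; split => x; first by move=> [? [_ ?]].
  by move=> [x1 Vx]; split=> //; split=> //; exact: circX.
Qed.

(** The component N of x in A `&` U is open in A, because each of its points has a
    neighbourhood in A inside its own component, which is N. *)
Lemma connected_im_kleinen_locally_connected (T : topologicalType) (A : set T) :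
  (forall x (U : set T), open U -> U x -> A x ->
    \forall y \near x, A y -> connected_component (A `&` U) x y) ->
  locally_connected A.
Proof.
move=> cik x U Ax oU Ux.
pose N := connected_component (A `&` U) x.
have NAU : N `<=` A `&` U by exact: connected_component_sub.
exists (interior [set y | A y -> N y]).
have AV : A `&` interior [set y | A y -> N y] = N.
  apply/seteqP; split => [y [Ay /interior_subset /(_ Ay)] //|y Ny].
  have [Ay Uy] := NAU y Ny; split=> //.
  have := cik y U oU Uy Ay; apply: filterS => w Hw Aw.
  exact: connected_component_trans Ny (Hw Aw).
rewrite AV; split; first exact: open_interior.
- by have := cik x U oU Ux Ax.
- by move=> y /NAU[].
- exact: component_connected.
Qed.

Lemma spectrum_locally_connected :
  locally_connected (@kneading_spectrum R `&` [set z : R[i] | 1 < cmod z]).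
Proof.
have -> : @kneading_spectrum R `&` [set z : R[i] | 1 < cmod z] = @outer_zeros R.
  apply/seteqP; split => [s [Ss s1]|s zs]; first exact/spectrum_outside.
  by have [s1 _] := zs; split => //; exact/spectrum_outside.
apply: connected_im_kleinen_locally_connected => x U oU Ux Ax; exact: outer_zeros_cik.
Qed.

End Conclusion.

Theorem proposition3p1 (R : realType) :
  connected (@kneading_spectrum R `&` [set z : R[i] | 1 <= `|z|]) /\
  locally_connected (@kneading_spectrum R `&` [set z : R[i] | 1 < `|z|]).
Proof.
have e1 : [set z : R[i] | 1 <= `|z|] = [set z | 1 <= cmod z].
  by apply/funext => z; rewrite /= -lecR -cmodE.
have e2 : [set z : R[i] | 1 < `|z|] = [set z | 1 < cmod z].
  by apply/funext => z; rewrite /= -ltcR -cmodE.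
rewrite e1 e2; split; [exact: spectrum_connected|exact: spectrum_locally_connected].
Qed.
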